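(* Let $\omega>0$, let $p,q,b:\mathbb{R}\to\mathbb{R}$ and $c,e:\mathbb{R}\to(0,+\infty)$ be continuous $\omega$-periodic functions, let $\rho_1,\rho_2>0$ be constants with $\rho_1=\rho_2$, and put $\alpha=\frac{1}{\rho_1+1}$. Assume that the periodic Green's function $G$ associated with $u''+p(t)u'+\frac{q(t)}{\alpha}u$ exists and satisfies $G(t,s)>0$ for all $(t,s)\in[0,\omega]\times[0,\omega]$, and let $G^*,G_*,\sigma,\delta$ be the associated constants (see context). Suppose that $$\frac{(1-\alpha)(G^*+\delta G_* )\delta^2\omega}{\sigma}<1.$$ Consider the equation $$y''(t)+p(t)y'(t)+\frac{q(t)}{\alpha}y(t)=\frac{c(t)}{\alpha}y^{1-\alpha-\alpha\rho_2}(t)+\frac{e(t)}{\alpha}y^{1-\alpha}(t)+(1-\alpha)\frac{|y'(t)|^2}{y(t)}+\frac{b(t)}{\alpha}.\qquad(\ast)$$ Case I: if $b_*+c_*\geq0$, then there exist $R>r>0$ and a positive $\omega$-periodic solution $y$ of $(\ast)$ with $r\le\|y\|\le R$. Case II: if $b_*+c_*<0$ and $r>0$ satisfies $$\frac{1}{\sigma}\left(-\frac{b_*+c_*}{e_*}\right)^{\frac{1}{1-\alpha}}<r\leq\frac{G_*\bar{b}^+\omega}{\alpha},$$ then there exist $R>r$ and a positive $\omega$-periodic solution $y$ of $(\ast)$ with $r\le\|y\|\le R$. Consequently, in either case $x=y^\alpha$ is a positive $\omega$-periodic solution of $$x''(t)+p(t)x'(t)+q(t)x(t)=\frac{b(t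)}{x^{\rho_1}(t)}+\frac{c(t)}{x^{\rho_2}(t)}+e(t).$$
   Context: For a continuous $\omega$-periodic function $\phi$, write $\phi^*=\max_{0\le t\le\omega}\phi(t)$, $\phi_*=\min_{0\le t\le\omega}\phi(t)$ and $\|\phi\|_\infty=\max_{t\in[0,\omega]}|\phi(t)|$. For a $C^1$ $\omega$-periodic function, $\|\phi\|=\|\phi\|_\infty+\|\phi'\|_\infty$. Also $b^+(t)=\max\{0,b(t)\}$ and $\bar b^+=\frac1\omega\int_0^\omega b^+(t)\,dt$. Green's function: consider the periodic problem $u''(t)+p(t)u'(t)+\frac{q(t)}{\alpha}u(t)=h(t)$, $u(0)=u(\omega)$, $u'(0)=u'(\omega)$, with $h$ continuous and $\omega$-periodic. Existence of $G$ means that this problem has a unique solution for each such $h$, i.e. the homogeneous periodic problem has only the trivial solution; $G(t,s)$, $(t,s)\in[0,\omega]\times[0,\omega]$, is then the continuous function for which the unique solution is $u(t)=\int_0^\omega G(t,s)h(s)\,ds$. Constants: $G^*=\max_{0\le s,t\le\omega}G(t,s)$, $G_*=\min_{0\le s,t\le\omega}G(t,s)$, and, with $D=\max_{0\le s,t\le\omega}\left|\frac{\partial G(t,s)}{\partial t}\right|$ (on the diagonal $t=s$ the derivative is understood through its one-sided values, so $D$ is the supremum over $t\ne s$), $$\sigma=\frac{G_*}{G^*+D},\qquad \delta=\frac{D}{G_*}.$$ A positive $\omega$-periodic solution is a $C^2$, $\omega$-periodic function $\mathbb{R}\to(0,+\infty)$ satisfying the equation for all $t$. *)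

(* Defs.v *)
From Stdlib Require Import Reals.
From Coquelicot Require Import Coquelicot.
Open Scope R_scope.

Definition periodic (omega : R) (f : R -> R) : Prop :=
  forall t, f (t + omega) = f t.

Definition continuous_periodic (omega : R) (f : R -> R) : Prop :=
  (forall t, continuous f t) /\ periodic omega f.

Definition period_interval (omega : R) : R -> Prop :=
  fun t => 0 <= t <= omega.

Definition period_square (omega : R) : R * R -> Prop :=
  fun z => period_interval omega (fst z) /\ period_interval omega (snd z).

Definition is_max_on {T : Type} (A : T -> Prop) (f : T -> R) (m : R) : Prop :=
  (exists x, A x /\ f x = m) /\ (forall x, A x -> f x <= m).

Definition is_min_on {T : Type} (A : T -> Prop) (f : T -> R) (m : R) : Prop :=
  (exists x, A x /\ f x = m) /\ (forall x, A x -> m <= f x).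

(* N = max |y| + max |y'|, the maxima being over [0, omega]. *)
Definition is_C1_norm (omega : R) (y : R -> R) (N : R) : Prop :=
  exists m0 m1 : R,
    is_max_on (period_interval omega) (fun t => Rabs (y t)) m0 /\
    is_max_on (period_interval omega) (fun t => Rabs (Derive y t)) m1 /\
    N = m0 + m1.

Definition mean_pos_part (omega : R) (b : R -> R) : R :=
  / omega * RInt (fun t => Rmax 0 (b t)) 0 omega.

(* u'' + p u' + k u = h on [0, omega], u(0) = u(omega), u'(0) = u'(omega).
   Derivatives are relative to [0, omega], hence one-sided at the endpoints,
   and only the values of u on [0, omega] matter. For continuous p, k and h the
   equation makes u'' continuous, so that u is C^2 on [0, omega]. *)
Definition solves_periodic_problem
    (omega : R) (p k h u : R -> R) : Prop :=
  exists u1 u2 : R -> R,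
    (forall t, period_interval omega t ->
       D_in u u1 (period_interval omega) t /\
       D_in u1 u2 (period_interval omega) t /\
       u2 t + p t * u1 t + k t * u t = h t) /\
    u 0 = u omega /\ u1 0 = u1 omega.

Definition is_periodic_Green_function
    (omega : R) (p k : R -> R) (G : R -> R -> R) : Prop :=
  continuous_on (period_square omega) (fun z : R * R => G (fst z) (snd z)) /\
  forall h, continuous_periodic omega h ->
    solves_periodic_problem omega p k h
      (fun t => RInt (fun s => G t s * h s) 0 omega) /\
    (forall u, solves_periodic_problem omega p k h u ->
       forall t, period_interval omega t ->
         u t = RInt (fun s => G t s * h s) 0 omega).

(* The values |dG/dt (t, s)| with (t, s) in the square and t <> s. The diagonal,
   where dG/dt jumps, contributes only one-sided values, which are limits of
   these. At t = 0 and t = omega the derivative is one-sided. *)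
Definition Green_derivative_values (omega : R) (G : R -> R -> R) : R -> Prop :=
  fun x => exists t s d : R,
    period_interval omega t /\ period_interval omega s /\ t <> s /\
    D_in (fun tau => G tau s) (fun _ => d) (period_interval omega) t /\
    x = Rabs d.

Definition is_C2 (y : R -> R) : Prop :=
  forall t, ex_derive y t /\ ex_derive (Derive y) t /\
            continuous (Derive (Derive y)) t.

(* y is a positive omega-periodic C^2 solution of y'' + p y' + k y = f(t, y, y'). *)
Definition positive_periodic_solution
    (omega : R) (p k : R -> R) (f : R -> R -> R -> R) (y : R -> R) : Prop :=
  is_C2 y /\ periodic omega y /\ (forall t, 0 < y t) /\
  forall t,
    Derive (Derive y) t + p t * Derive y t + k t * y t
      = f t (y t) (Derive y t).

(* In both right-hand sides the last two arguments stand for the values of the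
   unknown function and of its derivative at t. *)
Definition singular_rhs (rho1 rho2 : R) (b c e : R -> R) (t x dx : R) : R :=
  b t / Rpower x rho1 + c t / Rpower x rho2 + e t.

Definition transformed_rhs
    (alpha rho2 : R) (b c e : R -> R) (t y dy : R) : R :=
  c t / alpha * Rpower y (1 - alpha - alpha * rho2)
  + e t / alpha * Rpower y (1 - alpha)
  + (1 - alpha) * (Rabs dy ^ 2 / y)
  + b t / alpha.

(* Main.v *)
(* Since rho1 = rho2, the exponent 1 - alpha - alpha rho2 vanishes and (star) reads
   y'' + p y' + k y = (b + c)/alpha + (e/alpha) y^(1-alpha) + (1-alpha) y'^2/y, k = q/alpha.
   Clamp y to [m, Rd] and y' to [-delta y, delta y] in the right-hand side, which makes
   it bounded, Lipschitz and nonnegative. Writing the Poincare map of the clamped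
   equation as (monodromy of the linear equation) + (bounded map), the nonresonance
   given by the Green's function reduces periodicity to a zero of a bounded
   perturbation of the identity of the plane, found by the Poincare-Miranda theorem.
   A periodic solution is y = int G(., s) h(s) ds with h >= 0, so
   Gmin int h <= y <= Gmax int h and |y'| <= D int h <= delta y; the lower bound on the
   right-hand side gives y >= m, sublinearity and the smallness condition give
   y <= Rd for large Rd, and the clamping is inactive. The bound on y' needs G to be
   D-Lipschitz in t, hence differentiable off the diagonal, which is derived
   from the defining property of G. *)
Require Import Defs.
From Stdlib Require Import Reals Lra Lia Psatz.
From Coquelicot Require Import Coquelicot.
Open Scope R_scope.

(** The order of the choices matters. The bound [m] comes from a function [beta] that minorizes the
    right-hand side whenever y is at least [m] and does not involve [Rd]; so [m] is fixed before
    [Rd], which can then be as large as the growth requires. The window for y' is proportional to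
    the clamped y, so that the clamped y'^2/y is at most delta^2 Rd: linear in [Rd], with no factor
    1/m. In the a priori bound y <= Gmax omega (sup h) this term contributes the coefficient Gmax
    omega (1-alpha) delta^2, which the smallness condition keeps below 1 because sigma <= 1 and
    delta Gmin >= 0; the remaining terms grow only like Rd^(1-alpha). The two cases differ only in
    the pair ([m], [beta]): m = (Gmin omega e_min/alpha)^(1/alpha) with the constant beta = e_min
    m^(1-alpha)/alpha in Case I, m = r with beta = b^+/alpha in Case II. Since the clamped equation
    is globally Lipschitz, its shooting map is defined for all initial data, and the fixed point
    problem stays in the plane instead of a function space. *)

Definition clamp (a b x : R) : R := Rmax a (Rmin b x).

Lemma clamp_bounds (a b x : R) : a <= b -> a <= clamp a b x <= b.
Proof.
  intros Hab; unfold clamp, Rmax, Rmin.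
  destruct (Rle_dec b x); destruct (Rle_dec a _); lra.
Qed.

Lemma clamp_id (a b x : R) : a <= x <= b -> clamp a b x = x.
Proof.
  intros Hx; unfold clamp, Rmax, Rmin.
  destruct (Rle_dec b x); destruct (Rle_dec a _); lra.
Qed.

(** The endpoints vary too, because the derivative will be clamped to an interval that depends on
    the value of the function. *)
Lemma clamp_lipschitz (a a' b b' x x' : R) :
  Rabs (clamp a b x - clamp a' b' x')
    <= Rmax (Rabs (a - a')) (Rmax (Rabs (b - b')) (Rabs (x - x'))).
Proof.
  unfold clamp, Rmax, Rmin, Rabs.
  repeat destruct (Rle_dec _ _); repeat destruct (Rcase_abs _); lra.
Qed.

Lemma continuous_of_lipschitz (f : R -> R) (L : R) :
  (forall x y, Rabs (f x - f y) <= L * Rabs (x - y)) ->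
  forall x, continuous f x.
Proof.
  intros Hf x; apply filterlim_locally; intros eps.
  assert (HL : 0 < Rabs L + 1) by (pose proof (Rabs_pos L); lra).
  assert (Hd : 0 < eps / (Rabs L + 1))
    by (apply Rdiv_lt_0_compat; [apply cond_pos | exact HL]).
  exists (mkposreal _ Hd); intros y Hy.
  change (Rabs (y - x) < eps / (Rabs L + 1)) in Hy.
  change (Rabs (f y - f x) < eps).
  apply Rle_lt_trans with (1 := Hf y x).
  apply (Rmult_lt_compat_l _ _ _ HL) in Hy.
  replace ((Rabs L + 1) * (eps / (Rabs L + 1))) with (pos eps) in Hy
    by (field; lra).
  apply Rle_lt_trans with (2 := Hy), Rmult_le_compat_r; [apply Rabs_pos|].
  pose proof (Rle_abs L); lra.
Qed.

Lemma continuous_clamp (a b x : R) : continuous (clamp a b) x.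
Proof.
  apply (continuous_of_lipschitz _ 1); intros u v.
  apply Rle_trans with (1 := clamp_lipschitz a a b b u v).
  rewrite !Rminus_diag, !Rabs_R0, Rmult_1_l.
  repeat apply Rmax_lub; try apply Rabs_pos; apply Rle_refl.
Qed.

(** * Planar zeros *)

(* The colour of a grid point is 0 if [a] holds there, 1 if only [b] holds, 2 if
   neither does; a door is an edge between colours 1 and 2. *)
Definition door (a b : nat -> nat -> bool) (i j i' j' : nat) : bool :=
  negb (a i j) && negb (a i' j') && xorb (b i j) (b i' j').

Fixpoint column_parity (a b : nat -> nat -> bool) (i n : nat) : bool :=
  match n with
  | O => false
  | S n' => xorb (column_parity a b i n') (door a b i n' i (S n'))
  end.

Lemma bool_jump (f : nat -> bool) (n : nat) :
  f O <> f n -> exists i, (i < n)%nat /\ f i <> f (S i).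
Proof.
  induction n as [|n IH]; intros Hf; [now elim Hf|].
  destruct (Bool.bool_dec (f O) (f n)) as [H0n|H0n].
  - exists n; split; [lia | congruence].
  - destruct (IH H0n) as [i [Hi Hfi]]; exists i; split; [lia | exact Hfi].
Qed.

(* Sperner's parity count, one dimension at a time: the number of doors on a
   vertical line changes parity between the left and the right side, hence
   across some strip, and in that strip across some unit square. *)
Lemma sperner_square (a b : nat -> nat -> bool) (n : nat) :
  (forall j, a O j = false) -> (forall j, a n j = true) ->
  (forall i, b i O = false) -> (forall i, b i n = true) ->
  exists i j, (i < n)%nat /\ (j < n)%nat /\
    forall f, f = a \/ f = b ->
      (exists k l, (k <= 1)%nat /\ (l <= 1)%nat /\ f (i + k)%nat (j + l)%nat = true) /\
      (exists k l, (k <= 1)%nat /\ (l <= 1)%nat /\ f (i + k)%nat (j + l)%nat = false).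
Proof.
  intros a0 an b0 bn.
  (* On the left side no point has colour 0, so doors are the changes of [b] and their parity
     telescopes; on the right side every point has colour 0 and there is no door. *)
  assert (left_odd : column_parity a b O n = true).
  { enough (H : forall k, column_parity a b O k = b O k) by now rewrite H.
    induction k as [|k IH]; simpl; [now rewrite b0|].
    rewrite IH; unfold door; rewrite !a0; simpl.
    now destruct (b O k), (b O (S k)). }
  assert (right_even : forall k, column_parity a b n k = false).
  { induction k as [|k IH]; simpl; [easy|].
    rewrite IH; unfold door; now rewrite !an. }
  destruct (bool_jump (fun i => column_parity a b i n) n) as [i [Hi Hjump]].
  { now rewrite left_odd, right_even. }
  (* This counts, modulo 2, the doors on both sides of the strip below height [j] together with the
     horizontal edge at height [j]. Since [b] is constant on the bottom and on the top, those two
     edges are no doors, and the count is even at 0 and odd at [n]. Where it jumps, a unit square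
     has an odd number of doors on its boundary. *)
  destruct (bool_jump (fun j => xorb (xorb (column_parity a b i j)
              (column_parity a b (S i) j)) (door a b i j (S i) j)) n)
    as [j [Hj Hjump']].
  { simpl; unfold door at 1 2; rewrite !b0, !bn, !Bool.andb_false_r; simpl.
    now destruct (column_parity a b i n), (column_parity a b (S i) n). }
  simpl in Hjump'; unfold door in Hjump'.
  exists i, j; split; [exact Hi|]; split; [exact Hj|].
  intros f Hf.
  (* With an odd number of boundary doors neither [a] nor [b] is constant on the corners: if [a] is
     constantly true or [b] is constant there is no door, and if [a] is constantly false the doors
     are the changes of [b] around a closed loop, an even number. *)
  assert (H : (f i j || f (S i) j || f i (S j) || f (S i) (S j) = true)%bool /\
              (f i j && f (S i) j && f i (S j) && f (S i) (S j) = false)%bool).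
  { destruct (column_parity a b i j), (column_parity a b (S i) j);
    destruct Hf; subst f;
    destruct (a i j), (a (S i) j), (a i (S j)), (a (S i) (S j)),
      (b i j), (b (S i) j), (b i (S j)), (b (S i) (S j));
      simpl in *; (split; reflexivity) || (now elim Hjump'). }
  assert (Hc : forall v, f i j = v \/ f (S i) j = v \/ f i (S j) = v \/ f (S i) (S j) = v ->
     exists k l, (k <= 1)%nat /\ (l <= 1)%nat /\ f (i + k)%nat (j + l)%nat = v).
  { intros v [Hv|[Hv|[Hv|Hv]]];
      [exists O, O | exists 1%nat, O | exists O, 1%nat | exists 1%nat, 1%nat];
      rewrite ?Nat.add_0_r, ?Nat.add_1_r; auto with arith. }
  destruct H as [H1 H2]; split; apply Hc;
    destruct (f i j), (f (S i) j), (f i (S j)), (f (S i) (S j)); simpl in *; auto.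
Qed.

(** Within distance h/(4 Lam) in each coordinate a function with this Lipschitz constant keeps half
    of its value, and finitely many such neighbourhoods cover the square. *)
Lemma positive_on_square_bounded_below (K Lam : R) (h : R -> R -> R) :
  0 < Lam ->
  (forall x y x' y', h x y - h x' y' <= Lam * (Rabs (x - x') + Rabs (y - y'))) ->
  (forall x y, -K <= x <= K -> -K <= y <= K -> 0 < h x y) ->
  exists d, 0 < d /\ forall x y, -K <= x <= K -> -K <= y <= K -> d <= h x y.
Proof.
  intros HLam Hlip Hpos.
  (* The gauge must be positive on the whole plane; the default 1 is used only where [h] is not
     positive, hence only outside the square. *)
  set (delta0 := fun x y => Rmax (h x y) 0 / (4 * Lam)
     + (if Rlt_dec 0 (h x y) then 0 else 1)).
  assert (Hd0 : forall x y, 0 < delta0 x y).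
  { intros x y; unfold delta0; destruct (Rlt_dec 0 (h x y)) as [H|H].
    - rewrite Rmax_left by lra; rewrite Rplus_0_r; apply Rdiv_lt_0_compat; lra.
    - rewrite Rmax_right by lra; unfold Rdiv; lra. }
  destruct (compactness_value_2d (-K) K (-K) K
              (fun x y => mkposreal _ (Hd0 x y))) as [d Hd].
  exists (2 * Lam * d); split.
  { pose proof (cond_pos d); nra. }
  intros x y Hx Hy; apply Rnot_lt_le; intros Habs.
  apply (Hd x y Hx Hy); intros [u [v [Hu [Hv [Hxu [Hyv Hdd]]]]]].
  simpl in *; unfold delta0 in *.
  destruct (Rlt_dec 0 (h u v)) as [H|H]; [|now apply H, Hpos].
  rewrite Rmax_left, Rplus_0_r in * by lra.
  specialize (Hlip u v x y).
  rewrite (Rabs_minus_sym u x), (Rabs_minus_sym v y) in Hlip.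
  set (q := h u v / (4 * Lam)) in *.
  assert (Hq : h u v = 4 * Lam * q) by (unfold q; field; lra).
  nra.
Qed.

(** Without a zero, |g1| + |g2| is at least some d > 0 on the square. Colouring a grid of mesh [st]
    by the signs of [g1] and [g2] yields a cell in which both change sign; there each is at most 2
    Lam st in absolute value, which contradicts d once the mesh is small. *)
Theorem poincare_miranda (K Lam : R) (g1 g2 : R -> R -> R) :
  0 < K ->
  (forall x y x' y',
     Rabs (g1 x y - g1 x' y') <= Lam * (Rabs (x - x') + Rabs (y - y'))) ->
  (forall x y x' y',
     Rabs (g2 x y - g2 x' y') <= Lam * (Rabs (x - x') + Rabs (y - y'))) ->
  (forall y, g1 (-K) y < 0 < g1 K y) ->
  (forall x, g2 x (-K) < 0 < g2 x K) ->
  exists x y, g1 x y = 0 /\ g2 x y = 0.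
Proof.
  intros HK L1 L2 S1 S2.
  assert (HLam : 0 < Lam).
  { specialize (L1 K 0 (-K) 0); specialize (S1 0).
    rewrite Rminus_diag, Rabs_R0, Rplus_0_r in L1.
    rewrite !Rabs_pos_eq in L1 by lra; nra. }
  apply Classical_Prop.NNPP; intros Hno.
  destruct (positive_on_square_bounded_below K (2 * Lam)
              (fun x y => Rabs (g1 x y) + Rabs (g2 x y))) as [d [Hd Hmin]].
  - lra.
  - intros x y x' y'; specialize (L1 x y x' y'); specialize (L2 x y x' y').
    pose proof (Rabs_triang_inv (g1 x y) (g1 x' y')).
    pose proof (Rabs_triang_inv (g2 x y) (g2 x' y')); lra.
  - intros x y _ _.
    pose proof (Rabs_pos (g1 x y)); pose proof (Rabs_pos (g2 x y)).
    destruct (Req_dec (g1 x y) 0) as [E1|N1].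
    + destruct (Req_dec (g2 x y) 0) as [E2|N2].
      * elim Hno; now exists x, y.
      * pose proof (Rabs_pos_lt _ N2); lra.
    + pose proof (Rabs_pos_lt _ N1); lra.
  (* The number of cells per side must exceed 16 Lam K / d, so that the mesh 2K/n satisfies 8 Lam st
     < d. *)
  - assert (Hdn : 0 < d / (16 * Lam * K))
      by (apply Rdiv_lt_0_compat; [lra | nra]).
    destruct (nfloor_ex (/ (d / (16 * Lam * K)))) as [n0 [_ Hn0]].
    { left; now apply Rinv_0_lt_compat. }
    set (n := S n0); rewrite <- S_INR in Hn0; fold n in Hn0.
    assert (Hn : 0 < INR n) by (apply lt_0_INR; unfold n; lia).
    set (st := 2 * K / INR n).
    assert (Hst : 0 < st) by (apply Rdiv_lt_0_compat; lra).
    assert (Hsmall : 8 * Lam * st < d).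
    { unfold st.
      apply (Rmult_lt_compat_l (d / (16 * Lam * K))) in Hn0; [|exact Hdn].
      rewrite Rinv_r in Hn0 by lra.
      apply (Rmult_lt_reg_r (INR n)); [exact Hn|].
      replace (8 * Lam * (2 * K / INR n) * INR n) with (16 * Lam * K) by (field; lra).
      apply (Rmult_lt_reg_l (/ (16 * Lam * K))).
      - apply Rinv_0_lt_compat; nra.
      - rewrite Rinv_l by nra; unfold Rdiv in Hn0; lra. }
    set (pt := fun i => -K + INR i * st).
    assert (Hpt0 : pt O = -K) by (unfold pt; simpl; ring).
    assert (Hptn : pt n = K) by (unfold pt, st; field; lra).
    set (sgn := fun r => if Rlt_dec 0 r then true else false).
    assert (Hs1 : forall r, sgn r = true <-> 0 < r).
    { intros r; unfold sgn; destruct (Rlt_dec 0 r); split; easy. }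
    assert (Hs0 : forall r, sgn r = false <-> r <= 0).
    { intros r; unfold sgn; destruct (Rlt_dec 0 r); split; intros; try easy; lra. }
    destruct (sperner_square (fun i j => sgn (g1 (pt i) (pt j)))
                (fun i j => sgn (g2 (pt i) (pt j))) n)
      as [i [j [Hi [Hj Hij]]]].
    + intros j; apply Hs0; rewrite Hpt0; left; apply S1.
    + intros j; apply Hs1; rewrite Hptn; apply S1.
    + intros i; apply Hs0; rewrite Hpt0; left; apply S2.
    + intros i; apply Hs1; rewrite Hptn; apply S2.
    + assert (Hclose : forall i k, (k <= 1)%nat -> Rabs (pt i - pt (i + k)%nat) <= st).
      { intros i' k Hk; unfold pt; rewrite plus_INR.
        replace (- K + INR i' * st - (- K + (INR i' + INR k) * st))
          with (- (INR k * st)) by ring.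
        rewrite Rabs_Ropp, Rabs_pos_eq.
        - apply le_INR in Hk; simpl in Hk; nra.
        - apply Rmult_le_pos; [apply pos_INR | lra]. }
      assert (Hbox : forall i, (i < n)%nat -> -K <= pt i <= K).
      { intros i' Hi'; rewrite <- Hptn at 2; unfold pt; apply lt_INR in Hi'.
        pose proof (pos_INR i'); nra. }
      assert (Hz : forall g,
        (forall x y x' y',
           Rabs (g x y - g x' y') <= Lam * (Rabs (x - x') + Rabs (y - y'))) ->
        (exists k l, (k <= 1)%nat /\ (l <= 1)%nat /\
           sgn (g (pt (i + k)%nat) (pt (j + l)%nat)) = true) /\
        (exists k l, (k <= 1)%nat /\ (l <= 1)%nat /\
           sgn (g (pt (i + k)%nat) (pt (j + l)%nat)) = false) ->
        Rabs (g (pt i) (pt j)) <= 2 * Lam * st).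
      { intros g Lg [[k [l [Hk [Hl Hp]]]] [k' [l' [Hk' [Hl' Hm]]]]].
        apply Hs1 in Hp; apply Hs0 in Hm.
        pose proof (Lg (pt i) (pt j) (pt (i + k)%nat) (pt (j + l)%nat)) as B1.
        pose proof (Lg (pt i) (pt j) (pt (i + k')%nat) (pt (j + l')%nat)) as B2.
        pose proof (Hclose i k Hk); pose proof (Hclose j l Hl).
        pose proof (Hclose i k' Hk'); pose proof (Hclose j l' Hl').
        apply Rabs_le_between in B1; apply Rabs_le_between in B2.
        apply Rabs_le_between; nra. }
      pose proof (Hz g1 L1 (Hij _ (or_introl eq_refl))).
      pose proof (Hz g2 L2 (Hij _ (or_intror eq_refl))).
      specialize (Hmin (pt i) (pt j) (Hbox i Hi) (Hbox j Hj)); simpl in Hmin.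
      nra.
Qed.

(** * Initial value problems *)

Lemma derive_nonneg_le (f df : R -> R) (a b : R) :
  a <= b ->
  (forall t, a <= t <= b -> is_derive f t (df t)) ->
  (forall t, a <= t <= b -> 0 <= df t) ->
  f a <= f b.
Proof.
  intros Hab Hf Hdf.
  destruct (MVT_gen f a b df) as [c [Hc E]];
    rewrite ?Rmin_left, ?Rmax_right in * by exact Hab.
  - intros x Hx; apply Hf; lra.
  - intros x Hx; apply continuity_pt_filterlim.
    apply (ex_derive_continuous (V := R_NormedModule)).
    now exists (df x); apply Hf.
  - specialize (Hdf c Hc); nra.
Qed.

Lemma ex_RInt_of_continuous (f : R -> R) (a b : R) :
  (forall t, continuous f t) -> ex_RInt f a b.
Proof.
  intros Hf; apply (ex_RInt_continuous (V := R_CompleteNormedModule)); auto.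
Qed.

Lemma is_derive_RInt_of_continuous (f : R -> R) (a t : R) :
  (forall s, continuous f s) -> is_derive (RInt f a) t (f t).
Proof.
  intros Hf; apply (is_derive_RInt f (RInt f a) a); [|apply Hf].
  apply filter_forall; intros x.
  apply (RInt_correct (V := R_CompleteNormedModule)), ex_RInt_of_continuous, Hf.
Qed.

Lemma continuous_of_is_derive (f df : R -> R) :
  (forall t, is_derive f t (df t)) -> forall t, continuous f t.
Proof.
  intros Hf t; apply (ex_derive_continuous (V := R_NormedModule)).
  now exists (df t).
Qed.

(** * Energy estimate for u' = v, v' = r *)

Section Energy.

Variables (u v r : R -> R) (a b L H : R).
Hypotheses (hab : a <= b) (hL : 0 <= L) (hH : 0 <= H).
Hypothesis hu : forall t, a <= t <= b -> is_derive u t (v t).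
Hypothesis hv : forall t, a <= t <= b -> is_derive v t (r t).
Hypothesis hr : forall t, a <= t <= b ->
  Rabs (r t) <= L * (Rabs (u t) + Rabs (v t)) + H.

(** The constant summand absorbs the source term through 2 H |v| <= v^2 + H^2, so that [E] obeys a
    homogeneous differential inequality. H = 0 serves uniqueness and Lipschitz dependence on the
    data; H > 0 serves the comparison of a bounded nonlinearity with the linear flow. *)
Let E t := u t ^ 2 + v t ^ 2 + H ^ 2.

(** In the constant, 2 comes from 2|uv| and 2H|v|, and 3L from 2L|v|(|u| + |v|), each product being
    split by 2xy <= x^2 + y^2. *)
Lemma energy_derive_bound t : a <= t <= b ->
  Rabs (2 * u t * v t + 2 * v t * r t) <= (2 + 3 * L) * E t.
Proof.
  intros Ht; specialize (hr t Ht); unfold E.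
  apply Rle_trans with
    (2 * (Rabs (u t) * Rabs (v t)) + 2 * (Rabs (v t) * Rabs (r t))).
  - rewrite <- !Rabs_mult.
    apply Rle_trans with (1 := Rabs_triang _ _).
    rewrite !Rmult_assoc, !(Rabs_mult 2), (Rabs_pos_eq 2) by lra; lra.
  - rewrite <- (pow2_abs (u t)), <- (pow2_abs (v t)).
    set (x := Rabs (u t)) in *; set (y := Rabs (v t)) in *.
    assert (0 <= x) by apply Rabs_pos; assert (0 <= y) by apply Rabs_pos.
    assert (y * Rabs (r t) <= y * (L * (x + y) + H))
      by (apply Rmult_le_compat_l; lra).
    pose proof (pow2_ge_0 (x - y)); pose proof (pow2_ge_0 (y - H)).
    assert (0 <= L * (x - y) ^ 2) by (apply Rmult_le_pos; lra).
    assert (0 <= L * H ^ 2) by (apply Rmult_le_pos; [lra | apply pow2_ge_0]).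
    assert (0 <= L * x ^ 2) by (apply Rmult_le_pos; [lra | apply pow2_ge_0]).
    pose proof (pow2_ge_0 x); pose proof (pow2_ge_0 H).
    nra.
Qed.

Lemma energy_is_derive (k t : R) : a <= t <= b ->
  is_derive (fun s => E s * exp (k * s)) t
    ((2 * u t * v t + 2 * v t * r t + k * E t) * exp (k * t)).
Proof.
  intros Ht; unfold E; auto_derive.
  - repeat split; [now exists (v t); apply hu | now exists (r t); apply hv].
  - replace (Derive (fun x => u x) t) with (v t)
      by (symmetry; apply is_derive_unique, (hu t Ht)).
    replace (Derive (fun x => v x) t) with (r t)
      by (symmetry; apply is_derive_unique, (hv t Ht)).
    ring.
Qed.

(** Gronwall in both time directions: E exp(-ks) is nonincreasing and E exp(ks) nondecreasing. The
    backward bound is what propagates zero data from a point to the times before it. *)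
Lemma energy_bounds :
  E b <= E a * exp ((2 + 3 * L) * (b - a)) /\
  E a <= E b * exp ((2 + 3 * L) * (b - a)).
Proof.
  set (k := 2 + 3 * L).
  assert (Hd : forall t, a <= t <= b ->
    - (k * E t) <= 2 * u t * v t + 2 * v t * r t <= k * E t).
  { intros t Ht; apply Rabs_le_between, (energy_derive_bound t Ht). }
  split.
  - assert (Hm : - (E a * exp (- k * a)) <= - (E b * exp (- k * b))).
    { apply (derive_nonneg_le (fun s => - (E s * exp (- k * s))) _ a b hab
        (fun t Ht => is_derive_opp _ _ _ (energy_is_derive (- k) t Ht))).
      intros t Ht; specialize (Hd t Ht); pose proof (exp_pos (- k * t)).
      change (0 <= - ((2 * u t * v t + 2 * v t * r t + - k * E t) * exp (- k * t))).
      nra. }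
    apply (Rmult_le_reg_r (exp (- k * b))); [apply exp_pos|].
    rewrite Rmult_assoc, <- exp_plus.
    replace (k * (b - a) + - k * b) with (- k * a) by ring; lra.
  - assert (Hm : E a * exp (k * a) <= E b * exp (k * b)).
    { apply (derive_nonneg_le _ _ a b hab (energy_is_derive k)).
      intros t Ht; specialize (Hd t Ht); pose proof (exp_pos (k * t)); nra. }
    apply (Rmult_le_reg_r (exp (k * a))); [apply exp_pos|].
    rewrite Rmult_assoc, <- exp_plus.
    replace (k * (b - a) + k * a) with (k * b) by ring; exact Hm.
Qed.

End Energy.

(** * Convergence at the rate 2^(-n) *)

Lemma geometric_small (M eps : R) : 0 < eps -> exists n, M / 2 ^ n < eps.
Proof.
  intros Heps.
  assert (Hl : is_lim_seq (fun n => M * (/ 2) ^ n) 0).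
  { replace (Finite 0) with (Rbar_mult M 0) by (simpl; f_equal; ring).
    apply is_lim_seq_scal_l, is_lim_seq_geom; rewrite Rabs_pos_eq; lra. }
  apply is_lim_seq_spec in Hl; destruct (Hl (mkposreal _ Heps)) as [n Hn].
  specialize (Hn n (le_n _)); simpl in Hn; exists n.
  rewrite Rminus_0_r, pow_inv in Hn.
  apply Rle_lt_trans with (2 := Hn), Rle_abs.
Qed.

Lemma geometric_eq_0 (M x : R) : (forall n, Rabs x <= M / 2 ^ n) -> x = 0.
Proof.
  intros Hx; apply Classical_Prop.NNPP; intros Hne.
  destruct (geometric_small M (Rabs x)) as [n Hn]; [now apply Rabs_pos_lt|].
  specialize (Hx n); lra.
Qed.

Lemma geometric_tail (f : nat -> R) (K : R) :
  (forall n, Rabs (f (S n) - f n) <= K / 2 ^ n) ->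
  forall n, Rabs (f n - real (Lim_seq f)) <= 2 * K / 2 ^ n.
Proof.
  intros Hf n.
  assert (Hp : forall m, 0 < 2 ^ m) by (intros m; apply pow_lt; lra).
  assert (Htail : forall m k, Rabs (f (m + k)%nat - f m) <= 2 * K / 2 ^ m).
  { intros m k.
    (* The subtracted term is the exact geometric remainder, without which the induction on [k]
       would not close. *)
    enough (H : Rabs (f (m + k)%nat - f m) <= 2 * K / 2 ^ m - 2 * K / 2 ^ (m + k)).
    { apply Rle_trans with (1 := H).
      assert (0 <= K) by (pose proof (Rle_trans _ _ _ (Rabs_pos _) (Hf O)); simpl in *; lra).
      assert (0 <= 2 * K / 2 ^ (m + k)) by (apply Rdiv_le_0_compat; [lra | apply Hp]).
      lra. }
    induction k as [|k IH].
    - rewrite Nat.add_0_r, !Rminus_diag, Rabs_R0; lra.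
    - rewrite Nat.add_succ_r.
      replace (f (S (m + k)) - f m)
        with ((f (S (m + k)) - f (m + k)%nat) + (f (m + k)%nat - f m)) by ring.
      apply Rle_trans with (1 := Rabs_triang _ _).
      specialize (Hf (m + k)%nat).
      replace (2 * K / 2 ^ S (m + k)) with (K / 2 ^ (m + k)).
      + replace (2 * K / 2 ^ (m + k)) with (2 * (K / 2 ^ (m + k))) in IH by (field; apply Rgt_not_eq, Hp).
        lra.
      + simpl; field; apply Rgt_not_eq, Hp. }
  assert (Hex : ex_finite_lim_seq f).
  { apply ex_lim_seq_cauchy_corr; intros eps.
    destruct (geometric_small (2 * (2 * K)) eps) as [N HN]; [apply cond_pos|].
    exists N; intros i j Hi Hj.
    replace i with (N + (i - N))%nat by lia; replace j with (N + (j - N))%nat by lia.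
    pose proof (Htail N (i - N)%nat) as B1; pose proof (Htail N (j - N)%nat) as B2.
    apply Rabs_le_between in B1; apply Rabs_le_between in B2.
    apply Rabs_lt_between.
    replace (2 * (2 * K) / 2 ^ N) with (2 * (2 * K / 2 ^ N)) in HN by (field; apply Rgt_not_eq, Hp).
    lra. }
  apply Lim_seq_correct' in Hex.
  set (l := real (Lim_seq f)) in *.
  apply (is_lim_seq_incr_n _ n) in Hex.
  assert (Hc : is_lim_seq (fun k => Rabs (f n - f (k + n)%nat)) (Rabs (f n - l))).
  { apply (is_lim_seq_abs _ (Finite (f n - l))).
    apply is_lim_seq_minus'; [apply is_lim_seq_const | exact Hex]. }
  apply (is_lim_seq_le _ (fun _ => 2 * K / 2 ^ n) _ (2 * K / 2 ^ n)) in Hc;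
    [exact Hc | | apply is_lim_seq_const].
  intros k; rewrite Nat.add_comm, Rabs_minus_sym; apply Htail.
Qed.

Lemma continuous_geometric_limit (f : nat -> R -> R) (F : R -> R) (K : R) :
  (forall n t, continuous (f n) t) ->
  (forall n t, Rabs (f n t - F t) <= K / 2 ^ n) ->
  forall t, continuous F t.
Proof.
  intros Hf HF t; apply filterlim_locally; intros eps.
  destruct (geometric_small K (eps / 3)) as [n Hn];
    [apply Rdiv_lt_0_compat; [apply cond_pos | lra]|].
  assert (He : 0 < eps / 3) by (apply Rdiv_lt_0_compat; [apply cond_pos | lra]).
  pose proof (proj1 (filterlim_locally _ _) (Hf n t) (mkposreal _ He)) as Hl.
  revert Hl; apply filter_imp; intros s Hs.
  change (Rabs (f n s - f n t) < eps / 3) in Hs.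
  change (Rabs (F s - F t) < eps).
  pose proof (HF n s) as B1; pose proof (HF n t) as B2.
  apply Rabs_lt_between in Hs.
  apply Rabs_le_between in B1; apply Rabs_le_between in B2.
  apply Rabs_lt_between; lra.
Qed.

Section InitialValueProblem.

Variables (omega L : R) (g : R -> R -> R -> R).
Hypotheses (homega : 0 < omega) (hL : 0 <= L).
Hypothesis hg_lip : forall t u v u' v',
  Rabs (g t u v - g t u' v') <= L * (Rabs (u - u') + Rabs (v - v')).
Hypothesis hg_cont : forall u v : R -> R,
  (forall t, continuous u t) -> (forall t, continuous v t) ->
  forall t, continuous (fun s => g s (u s) (v s)) t.

Variables (u0 v0 : R).

Let cl := clamp 0 omega.

(** Integrating up to [cl t] instead of [t] freezes the iterates outside [0, omega]. Estimates on
    [0, omega] thus hold for all real t, and the iterates are continuous everywhere. *)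
Fixpoint picard (n : nat) : (R -> R) * (R -> R) :=
  match n with
  | O => (fun _ => u0, fun _ => v0)
  | S n' => let z := picard n' in
      (fun t => u0 + RInt (snd z) 0 (cl t),
       fun t => v0 + RInt (fun s => g s (fst z s) (snd z s)) 0 (cl t))
  end.

Lemma continuous_clamped_integral (c : R) (f : R -> R) :
  (forall t, continuous f t) ->
  forall t, continuous (fun t => c + RInt f 0 (cl t)) t.
Proof.
  intros Hf t.
  apply (continuous_plus (V := R_NormedModule)); [apply continuous_const|].
  apply continuous_comp; [apply continuous_clamp|].
  now apply (continuous_of_is_derive _ f); intros s; apply is_derive_RInt_of_continuous.
Qed.

Lemma picard_continuous n :
  (forall t, continuous (fst (picard n)) t) /\
  (forall t, continuous (snd (picard n)) t).
Proof.
  induction n as [|n [IH1 IH2]]; simpl.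
  - split; intros t; apply continuous_const.
  - split; intros t; apply continuous_clamped_integral; auto.
Qed.

Lemma clamped_time_bounds t : 0 <= cl t <= omega.
Proof. apply clamp_bounds; lra. Qed.

Lemma RInt_diff_bound (f h k : R -> R) (t : R) : 0 <= t ->
  (forall t, continuous f t) -> (forall t, continuous h t) ->
  (forall t, continuous k t) ->
  (forall s, 0 <= s <= t -> Rabs (f s - h s) <= k s) ->
  Rabs (RInt f 0 t - RInt h 0 t) <= RInt k 0 t.
Proof.
  intros Ht Hf Hh Hk Hb.
  assert (Hfh : forall s, continuous (fun s => f s - h s) s)
    by (intros s; apply (continuous_minus (V := R_NormedModule)); auto).
  replace (RInt f 0 t - RInt h 0 t) with (RInt (fun s => f s - h s) 0 t).
  2: { apply (RInt_minus (V := R_CompleteNormedModule) f h);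
         apply ex_RInt_of_continuous; auto. }
  apply Rle_trans with (RInt (fun s => Rabs (f s - h s)) 0 t).
  - apply abs_RInt_le; [exact Ht | now apply ex_RInt_of_continuous].
  - apply RInt_le; try exact Ht.
    + apply ex_RInt_of_continuous; intros s.
      apply continuous_comp; [apply Hfh | apply continuous_Rabs].
    + now apply ex_RInt_of_continuous.
    + intros s Hs; apply Hb; lra.
Qed.

Lemma picard_step_bound : exists K, forall n t,
  Rabs (fst (picard (S n)) t - fst (picard n) t) <= K / 2 ^ n /\
  Rabs (snd (picard (S n)) t - snd (picard n) t) <= K / 2 ^ n.
Proof.
  (* Weighting by [exp (Lam * t)] makes the Picard map a contraction of ratio 1/2. *)
  set (Lam := 2 * (1 + L)).
  set (d := fun n t => Rabs (fst (picard (S n)) t - fst (picard n) t)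
                     + Rabs (snd (picard (S n)) t - snd (picard n) t)).
  assert (Hdc : forall n t, continuous (d n) t).
  { intros n t; apply (continuous_plus (V := R_NormedModule));
    (apply continuous_comp; [|apply continuous_Rabs];
     apply (continuous_minus (V := R_NormedModule)); apply picard_continuous). }
  assert (Hdcl : forall n t, d n (cl t) = d n t).
  { intros n t; unfold d.
    assert (Hcc : cl (cl t) = cl t) by (apply clamp_id, clamped_time_bounds).
    destruct n; simpl; now rewrite Hcc. }
  destruct (continuity_ab_maj (d O) 0 omega) as [tm [Htm _]].
  { lra. }
  { intros c _; apply continuity_pt_filterlim, Hdc. }
  set (C := d O tm).
  assert (HC : 0 <= C)
    by (apply Rplus_le_le_0_compat; apply Rabs_pos).
  assert (Hd : forall n t, 0 <= t <= omega -> d n t <= C * exp (Lam * t) / 2 ^ n).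
  { induction n as [|n IH]; intros t Ht.
    - apply Rle_trans with (1 := Htm t Ht); fold C; simpl.
      pose proof (exp_ineq1_le (Lam * t)).
      assert (0 <= Lam * t) by (unfold Lam; nra); nra.
    - set (M := C / 2 ^ n).
      assert (HM : 0 <= M) by (apply Rdiv_le_0_compat; [exact HC | apply pow_lt; lra]).
      assert (Hc1 := proj1 (picard_continuous n)); assert (Hc2 := proj2 (picard_continuous n)).
      assert (Hc3 := proj1 (picard_continuous (S n))); assert (Hc4 := proj2 (picard_continuous (S n))).
      assert (Htcl : cl t = t) by now apply clamp_id.
      assert (B1 : Rabs (fst (picard (S (S n))) t - fst (picard (S n)) t) <= RInt (d n) 0 t).
      { change (fst (picard (S (S n))) t) with (u0 + RInt (snd (picard (S n))) 0 (cl t)).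
        change (fst (picard (S n)) t) with (u0 + RInt (snd (picard n)) 0 (cl t)).
        rewrite Htcl, Rminus_plus_l_l.
        apply RInt_diff_bound; auto; [lra|].
        intros s _; unfold d.
        pose proof (Rabs_pos (fst (picard (S n)) s - fst (picard n) s)); lra. }
      assert (B2 : Rabs (snd (picard (S (S n))) t - snd (picard (S n)) t) <= L * RInt (d n) 0 t).
      { change (snd (picard (S (S n))) t)
          with (v0 + RInt (fun s => g s (fst (picard (S n)) s) (snd (picard (S n)) s)) 0 (cl t)).
        change (snd (picard (S n)) t)
          with (v0 + RInt (fun s => g s (fst (picard n) s) (snd (picard n) s)) 0 (cl t)).
        rewrite Htcl, Rminus_plus_l_l.
        replace (L * RInt (d n) 0 t) with (RInt (fun s => L * d n s) 0 t)
          by (apply (RInt_scal (V := R_CompleteNormedModule)), ex_RInt_of_continuous; auto).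
        apply RInt_diff_bound; auto; [lra|].
        intros s; apply (continuous_scal_r (V := R_NormedModule)), Hdc. }
      assert (B3 : RInt (d n) 0 t <= RInt (fun s => M * exp (Lam * s)) 0 t).
      { assert (Hce : forall s, continuous (fun s => M * exp (Lam * s)) s)
          by (intros s; apply (ex_derive_continuous (V := R_NormedModule)); now auto_derive).
        apply RInt_le; [lra | now apply ex_RInt_of_continuous .. |].
        intros s Hs; apply Rle_trans with (1 := IH s (ltac:(lra))).
        right; unfold M; field; apply pow_nonzero; lra. }
      assert (HLam : 0 < Lam) by (unfold Lam; lra).
      assert (B4 : RInt (fun s => M * exp (Lam * s)) 0 t = M / Lam * exp (Lam * t) - M / Lam * exp (Lam * 0)).
      { apply is_RInt_unique.
        apply (is_RInt_derive (V := R_CompleteNormedModule) (fun s => M / Lam * exp (Lam * s))).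
        - intros s _; auto_derive; [easy | field; lra].
        - intros s _; apply (ex_derive_continuous (V := R_NormedModule)); now auto_derive. }
      rewrite Rmult_0_r, exp_0 in B4.
      unfold d; fold (d n).
      assert (HML : 0 <= M / Lam) by (apply Rdiv_le_0_compat; lra).
      (* The two components together gain the factor (1 + L)/Lam, which is 1/2 by the choice of
         [Lam]. *)
      replace (C * exp (Lam * t) / 2 ^ S n) with ((1 + L) * (M / Lam * exp (Lam * t))).
      + nra.
      + unfold M, Lam; simpl; field; repeat split; try (apply pow_nonzero); lra. }
  exists (C * exp (Lam * omega)); intros n t.
  assert (Hdt : d n t <= C * exp (Lam * omega) / 2 ^ n).
  { rewrite <- Hdcl; apply Rle_trans with (1 := Hd n (cl t) (clamped_time_bounds t)).
    apply Rmult_le_compat_r; [left; apply Rinv_0_lt_compat, pow_lt; lra|].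
    apply Rmult_le_compat_l; [exact HC|].
    pose proof (clamped_time_bounds t).
    destruct (Rle_lt_or_eq_dec (cl t) omega) as [Hlt|Heq]; [lra| |rewrite Heq; lra].
    left; apply exp_increasing; unfold Lam; nra. }
  unfold d in Hdt.
  pose proof (Rabs_pos (fst (picard (S n)) t - fst (picard n) t)).
  pose proof (Rabs_pos (snd (picard (S n)) t - snd (picard n) t)).
  split; lra.
Qed.

(** Passage to the limit in one component of the Picard recursion: the limit [x] satisfies the
    integral equation up to a multiple of 2^(-n), and letting n vary makes the defect zero. *)
Lemma clamped_integral_limit (c K M : R) (f fl x : R -> R) (t : R) (n : nat) :
  (forall t, continuous f t) -> (forall t, continuous fl t) ->
  (forall s, Rabs (f s - fl s) <= M / 2 ^ n) ->
  Rabs (c + RInt f 0 (cl t) - x t) <= K / 2 ^ n ->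
  Rabs (x t - (c + RInt fl 0 (cl t))) <= (K + omega * M) / 2 ^ n.
Proof.
  intros Hf Hfl Hd Hx.
  pose proof (clamped_time_bounds t) as Hcl.
  assert (HM : 0 <= M / 2 ^ n) by (apply Rle_trans with (2 := Hd 0), Rabs_pos).
  assert (B : Rabs (RInt f 0 (cl t) - RInt fl 0 (cl t)) <= RInt (fun _ => M / 2 ^ n) 0 (cl t)).
  { apply RInt_diff_bound; auto; [lra|].
    intros s; apply continuous_const. }
  rewrite RInt_const in B; change (scal (cl t - 0) (M / 2 ^ n)) with ((cl t - 0) * (M / 2 ^ n)) in B.
  replace ((K + omega * M) / 2 ^ n) with (K / 2 ^ n + omega * (M / 2 ^ n))
    by (field; apply pow_nonzero; lra).
  apply Rabs_le_between in B; apply Rabs_le_between in Hx.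
  apply Rabs_le_between; nra.
Qed.

(** The sigma type makes the solution a function of the initial data, from which the shooting map is
    built. The derivatives exist on the whole line, so they are two-sided at 0 and omega, while the
    equation is claimed on [0, omega] only. *)
Theorem initial_value_problem :
  {uv : (R -> R) * (R -> R) |
    fst uv 0 = u0 /\ snd uv 0 = v0 /\
    (forall t, is_derive (fst uv) t (snd uv t)) /\
    exists r : R -> R,
      (forall t, continuous r t) /\ (forall t, is_derive (snd uv) t (r t)) /\
      forall t, 0 <= t <= omega -> r t = g t (fst uv t) (snd uv t)}.
Proof.
  set (U := fun t => real (Lim_seq (fun n => fst (picard n) t))).
  set (V := fun t => real (Lim_seq (fun n => snd (picard n) t))).
  (* Unlike the limits [U] and [V], which are frozen outside [0, omega], [v] and [u] integrate up to
     [t] itself: they agree with [V] and [U] on [0, omega] and are differentiable at every point. *)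
  set (v := fun t => v0 + RInt (fun s => g s (U s) (V s)) 0 t).
  set (u := fun t => u0 + RInt v 0 t).
  exists (u, v); simpl.
  assert (HUV : exists K, forall n t,
    Rabs (fst (picard n) t - U t) <= K / 2 ^ n /\
    Rabs (snd (picard n) t - V t) <= K / 2 ^ n).
  { destruct picard_step_bound as [K HK]; exists (2 * K); intros n t; split.
    - apply (geometric_tail (fun m => fst (picard m) t) K); intros m; apply HK.
    - apply (geometric_tail (fun m => snd (picard m) t) K); intros m; apply HK. }
  destruct HUV as [K HK].
  assert (cU : forall t, continuous U t).
  { apply (continuous_geometric_limit (fun n => fst (picard n)) U K);
      [intros n; apply picard_continuous | intros n t; apply HK]. }
  assert (cV : forall t, continuous V t).
  { apply (continuous_geometric_limit (fun n => snd (picard n)) V K);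
      [intros n; apply picard_continuous | intros n t; apply HK]. }
  assert (cg : forall t, continuous (fun s => g s (U s) (V s)) t) by auto.
  assert (EU : forall t, U t = u0 + RInt V 0 (cl t)).
  { intros t; apply Rminus_diag_uniq, (geometric_eq_0 (K + omega * K)); intros n.
    apply (clamped_integral_limit u0 K K (snd (picard n)) V U).
    - apply picard_continuous.
    - exact cV.
    - intros s; apply HK.
    - apply Rle_trans with (1 := proj1 (HK (S n) t)).
      assert (HKp : 0 <= K).
      { pose proof (Rle_trans _ _ _ (Rabs_pos _) (proj1 (HK O 0))); simpl in *; lra. }
      apply Rmult_le_compat_l; [exact HKp|].
      apply Rinv_le_contravar; [apply pow_lt; lra|].
      apply Rle_pow; [lra | lia]. }
  assert (EV : forall t, V t = v0 + RInt (fun s => g s (U s) (V s)) 0 (cl t)).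
  { intros t; apply Rminus_diag_uniq, (geometric_eq_0 (K + omega * (L * (2 * K)))); intros n.
    apply (clamped_integral_limit v0 K (L * (2 * K))
      (fun s => g s (fst (picard n) s) (snd (picard n) s)) (fun s => g s (U s) (V s)) V).
    - apply hg_cont; apply picard_continuous.
    - exact cg.
    - intros s; apply Rle_trans with (1 := hg_lip _ _ _ _ _).
      replace (L * (2 * K) / 2 ^ n) with (L * (K / 2 ^ n + K / 2 ^ n))
        by (field; apply pow_nonzero; lra).
      apply Rmult_le_compat_l; [exact hL|].
      apply Rplus_le_compat; apply HK.
    - apply Rle_trans with (1 := proj2 (HK (S n) t)).
      assert (HKp : 0 <= K).
      { pose proof (Rle_trans _ _ _ (Rabs_pos _) (proj1 (HK O 0))); simpl in *; lra. }
      apply Rmult_le_compat_l; [exact HKp|].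
      apply Rinv_le_contravar; [apply pow_lt; lra|].
      apply Rle_pow; [lra | lia]. }
  assert (Ev : forall t, 0 <= t <= omega -> V t = v t).
  { intros t Ht; rewrite EV; unfold v, cl; now rewrite clamp_id. }
  assert (dv : forall t, is_derive v t (g t (U t) (V t))).
  { intros t; rewrite <- (Rplus_0_l (g t (U t) (V t))).
    apply (is_derive_plus (fun _ => v0)).
    - apply @is_derive_const.
    - now apply (is_derive_RInt_of_continuous (fun s => g s (U s) (V s))). }
  assert (cv := continuous_of_is_derive _ _ dv).
  assert (Eu : forall t, 0 <= t <= omega -> U t = u t).
  { intros t Ht; rewrite EU; unfold u, cl; rewrite clamp_id by exact Ht; f_equal.
    apply RInt_ext; intros s; rewrite Rmin_left, Rmax_right by lra.
    intros Hs; apply Ev; lra. }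
  split; [|split; [|split]].
  - unfold u; rewrite RInt_point; apply Rplus_0_r.
  - unfold v; rewrite RInt_point; apply Rplus_0_r.
  - intros t; rewrite <- (Rplus_0_l (v t)).
    apply (is_derive_plus (fun _ => u0)).
    + apply @is_derive_const.
    + now apply is_derive_RInt_of_continuous.
  - exists (fun s => g s (U s) (V s)); split; [exact cg | split; [exact dv|]].
    intros t Ht; now rewrite (Eu t Ht), (Ev t Ht).
Qed.

End InitialValueProblem.

(** * Periodic functions *)

Lemma periodic_IZR (omega : R) (f : R -> R) :
  periodic omega f -> forall (n : Z) t, f (t + IZR n * omega) = f t.
Proof.
  intros Hf n; induction n as [|n IH|n IH] using Z.peano_ind; intros t.
  - f_equal; ring.
  - rewrite succ_IZR, <- (IH t), <- (Hf (t + IZR n * omega)); f_equal; ring.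
  - rewrite <- (IH t), <- (Hf (t + IZR (Z.pred n) * omega)).
    rewrite <- Z.sub_1_r, minus_IZR; f_equal; ring.
Qed.

Lemma exists_period_shift (omega t : R) : 0 < omega ->
  exists n : Z, 0 <= t - IZR n * omega < omega.
Proof.
  intros Hom; exists (Int_part (t / omega)).
  destruct (base_Int_part (t / omega)) as [H1 H2].
  assert (E : t = t / omega * omega) by (field; lra).
  set (x := t / omega) in *; rewrite E at 1 2; nra.
Qed.

Lemma periodic_reduce (omega : R) (f : R -> R) (t : R) : 0 < omega ->
  periodic omega f -> exists s, 0 <= s <= omega /\ f t = f s.
Proof.
  intros Hom Hf; destruct (exists_period_shift omega t Hom) as [n Hn].
  exists (t - IZR n * omega); split; [lra|].
  rewrite <- (periodic_IZR omega f Hf n (t - IZR n * omega)); f_equal; ring.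
Qed.

Lemma continuous_periodic_bounded (omega : R) (f : R -> R) : 0 < omega ->
  continuous_periodic omega f -> exists M, 0 <= M /\ forall t, Rabs (f t) <= M.
Proof.
  intros Hom [Hc Hp].
  destruct (continuity_ab_maj (fun t => Rabs (f t)) 0 omega) as [tm [Hm _]].
  - lra.
  - intros c _; apply continuity_pt_filterlim.
    apply (continuous_comp f Rabs); [apply Hc | apply continuous_Rabs].
  - exists (Rabs (f tm)); split; [apply Rabs_pos|]; intros t.
    destruct (periodic_reduce omega f t Hom Hp) as [s [Hs ->]]; auto.
Qed.

(** The defining property of the Green's function speaks of continuous periodic right-hand sides,
    whereas those at hand are controlled on [0, omega] only. *)
Lemma periodic_extension (omega : R) (f : R -> R) : 0 < omega ->
  (forall t, continuous f t) -> f 0 = f omega ->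
  exists g, continuous_periodic omega g /\
    forall t, 0 <= t <= omega -> g t = f t.
Proof.
  intros Hom Hc H0.
  set (g := fun t => f (t - IZR (Int_part (t / omega)) * omega)).
  (* The formula holds on the closed period: at its right end [Int_part] has already moved on, and f
     0 = f omega compensates. *)
  assert (Hg : forall (n : Z) t, 0 <= t - IZR n * omega <= omega ->
                 g t = f (t - IZR n * omega)).
  { intros n t Hn; unfold g.
    assert (Et : t / omega * omega = t) by (field; lra).
    set (x := t / omega) in *.
    destruct (Req_dec (t - IZR n * omega) omega) as [He|He].
    - rewrite <- (Int_part_spec x (n + 1)).
      + rewrite plus_IZR.
        replace (t - (IZR n + 1) * omega) with 0 by lra.
        now rewrite He.
      + rewrite plus_IZR; nra.
    - now rewrite <- (Int_part_spec x n) by nra. }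
  exists g; split; [split|].
  - intros t0.
    destruct (exists_period_shift omega t0 Hom) as [n Hn].
    (* Around the junction of two periods, [g] is a sum of two clamped copies of [f]. *)
    set (fc := fun t => f (clamp 0 omega t)).
    assert (Hfc : forall c t, continuous (fun t => fc (t - c)) t).
    { intros c t; apply (continuous_comp (fun s => s - c) fc).
      - apply (continuous_minus (V := R_NormedModule));
          [apply continuous_id | apply continuous_const].
      - apply (continuous_comp (clamp 0 omega) f); [apply continuous_clamp | apply Hc]. }
    (* Right of the junction the earlier copy is frozen at f omega = f 0, left of it the later copy
       is frozen at f 0; subtracting f 0 leaves [g] on both sides. *)
    apply (continuous_ext_loc _
      (fun t => fc (t - (IZR n - 1) * omega) + fc (t - IZR n * omega) - f 0)).
    + assert (Hd : 0 < omega - (t0 - IZR n * omega)) by lra.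
      assert (Hr : 0 < Rmin omega (omega - (t0 - IZR n * omega))) by now apply Rmin_glb_lt.
      exists (mkposreal _ Hr); intros t Ht.
      change (Rabs (t - t0) < Rmin omega (omega - (t0 - IZR n * omega))) in Ht.
      pose proof (Rmin_l omega (omega - (t0 - IZR n * omega))).
      pose proof (Rmin_r omega (omega - (t0 - IZR n * omega))).
      apply Rabs_lt_between in Ht; unfold fc.
      match goal with |- ?x = ?y => change (x = y :> R) end.
      destruct (Rle_dec 0 (t - IZR n * omega)) as [Hpos|Hneg].
      * rewrite (Hg n t) by lra.
        rewrite (clamp_id 0 omega (t - IZR n * omega)) by lra.
        replace (clamp 0 omega (t - (IZR n - 1) * omega)) with omega.
        -- rewrite H0; lra.
        -- unfold clamp; rewrite Rmin_left by lra; rewrite Rmax_right; lra.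
      * rewrite (Hg (n - 1)%Z t) by (rewrite minus_IZR; lra).
        rewrite (clamp_id 0 omega (t - (IZR n - 1) * omega)) by lra.
        replace (clamp 0 omega (t - IZR n * omega)) with 0.
        -- rewrite minus_IZR; lra.
        -- unfold clamp; rewrite Rmin_right by lra; rewrite Rmax_left; lra.
    + apply (continuous_minus (V := R_NormedModule)); [|apply continuous_const].
      apply (continuous_plus (V := R_NormedModule)); apply Hfc.
  - intros t.
    destruct (exists_period_shift omega t Hom) as [n Hn].
    rewrite (Hg n t) by lra.
    rewrite (Hg (n + 1)%Z (t + omega)) by (rewrite plus_IZR; lra).
    f_equal; rewrite plus_IZR; ring.
  - intros t Ht; rewrite (Hg 0%Z t) by lra; f_equal; ring.
Qed.

(** If the determinant vanished, (b, -a) and (d, -c) would lie in the kernel, so the matrix would be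
    zero and (1, 0) would lie in it as well. *)
Lemma nonsingular_2x2 (a b c d : R) :
  (forall x y, a * x + b * y = 0 -> c * x + d * y = 0 -> x = 0 /\ y = 0) ->
  a * d - b * c <> 0.
Proof.
  intros Hinj Hdet.
  destruct (Hinj b (- a)); [ring | lra|].
  destruct (Hinj d (- c)); [lra | ring|].
  destruct (Hinj 1 0); lra.
Qed.

Lemma is_derive_of_D_in (f df : R -> R) (a b t : R) : a < t < b ->
  D_in f df (fun x => a <= x <= b) t -> is_derive f t (df t).
Proof.
  intros Ht H; apply is_derive_Reals; intros eps Heps.
  destruct (H eps Heps) as [dl [Hdl Hd]].
  assert (Hm : 0 < Rmin dl (Rmin (t - a) (b - t)))
    by (repeat apply Rmin_glb_lt; lra).
  exists (mkposreal _ Hm); intros h Hh0 Hh; simpl in Hh.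
  pose proof (Rmin_l dl (Rmin (t - a) (b - t))).
  pose proof (Rmin_r dl (Rmin (t - a) (b - t))).
  pose proof (Rmin_l (t - a) (b - t)); pose proof (Rmin_r (t - a) (b - t)).
  specialize (Hd (t + h)); unfold R_met, R_dist, D_x in Hd; simpl in Hd; unfold Rdist in Hd.
  replace (t + h - t) with h in Hd by ring.
  apply Hd; split; [split|lra].
  - apply Rabs_lt_between in Hh; lra.
  - lra.
Qed.

Lemma D_in_of_is_derive (f df : R -> R) (D : R -> Prop) (t : R) :
  is_derive f t (df t) -> D_in f df D t.
Proof.
  intros H; apply (D_in_imp f df no_cond); [easy|].
  now apply derivable_pt_lim_D_in, is_derive_Reals.
Qed.

Lemma derivative_le_lipschitz (f : R -> R) (a b t l M : R) : a < b -> a <= t <= b ->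
  (forall x y, a <= x <= b -> a <= y <= b -> Rabs (f x - f y) <= M * Rabs (x - y)) ->
  is_derive f t l -> Rabs l <= M.
Proof.
  intros Hab Ht Hlip Hl; apply Rnot_lt_le; intros Habs.
  apply is_derive_Reals in Hl.
  destruct (Hl (Rabs l - M)) as [dl Hdl]; [lra|].
  pose proof (cond_pos dl).
  set (m := Rmin (dl / 2) ((b - a) / 2)).
  assert (Hm : 0 < m) by (apply Rmin_glb_lt; lra).
  assert (m <= dl / 2) by apply Rmin_l; assert (m <= (b - a) / 2) by apply Rmin_r.
  (* The increment points towards the farther endpoint, so that t + h stays in [a, b] even when t is
     an endpoint. *)
  assert (Hh : exists h, Rabs h = m /\ a <= t + h <= b).
  { destruct (Rle_dec t ((a + b) / 2)).
    - exists m; rewrite Rabs_pos_eq; lra.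
    - exists (- m); rewrite Rabs_Ropp, Rabs_pos_eq; lra. }
  destruct Hh as [h [Eh Hh]].
  assert (Hh0 : h <> 0) by (intros ->; rewrite Rabs_R0 in Eh; lra).
  specialize (Hdl h Hh0 ltac:(lra)).
  specialize (Hlip (t + h) t Hh Ht).
  replace (t + h - t) with h in Hlip by ring.
  assert (Hq : Rabs ((f (t + h) - f t) / h) <= M).
  { rewrite Rabs_div by exact Hh0.
    apply Rle_div_l; [rewrite Eh; exact Hm | exact Hlip]. }
  pose proof (Rabs_triang_inv l ((f (t + h) - f t) / h)) as Hti.
  rewrite Rabs_minus_sym in Hti; lra.
Qed.

(** The primitive from [a] is squeezed to zero on [a, b], and its derivative at the interior point
    [s] is f s. *)
Lemma nonneg_integral_zero (f : R -> R) (a b s : R) : a < s < b ->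
  (forall t, continuous f t) -> (forall t, a <= t <= b -> 0 <= f t) ->
  RInt f a b = 0 -> f s = 0.
Proof.
  intros Hs Hc Hpos H0.
  assert (Hz : forall t, a <= t <= b -> RInt f a t = 0).
  { intros t Ht.
    pose proof (RInt_Chasles (V := R_CompleteNormedModule) f a t b
      (ex_RInt_of_continuous _ _ _ Hc) (ex_RInt_of_continuous _ _ _ Hc)) as E.
    change (RInt f a t + RInt f t b = RInt f a b) in E.
    assert (0 <= RInt f a t)
      by (apply RInt_ge_0; [lra | now apply ex_RInt_of_continuous | intros; apply Hpos; lra]).
    assert (0 <= RInt f t b)
      by (apply RInt_ge_0; [lra | now apply ex_RInt_of_continuous | intros; apply Hpos; lra]).
    lra. }
  pose proof (is_derive_RInt_of_continuous f a s Hc) as Hd.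
  apply is_derive_unique in Hd; rewrite <- Hd.
  apply is_derive_unique, (is_derive_ext_loc (fun _ => 0)).
  - assert (Hm : 0 < Rmin (s - a) (b - s)) by (apply Rmin_glb_lt; lra).
    exists (mkposreal _ Hm); intros t Ht.
    change (Rabs (t - s) < Rmin (s - a) (b - s)) in Ht.
    pose proof (Rmin_l (s - a) (b - s)); pose proof (Rmin_r (s - a) (b - s)).
    apply Rabs_lt_between in Ht; symmetry; apply Hz; lra.
  - apply @is_derive_const.
Qed.

(** * Linear equations and Green's functions *)

Definition homogeneous_solution (p k : R -> R) (a b : R) (u v : R -> R) : Prop :=
  forall t, a <= t <= b ->
    is_derive u t (v t) /\ is_derive v t (- p t * v t - k t * u t).

Lemma homogeneous_solution_combination (p k : R -> R) (a b c1 c2 : R) (u1 v1 u2 v2 : R -> R) :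
  homogeneous_solution p k a b u1 v1 -> homogeneous_solution p k a b u2 v2 ->
  homogeneous_solution p k a b
    (fun t => c1 * u1 t + c2 * u2 t) (fun t => c1 * v1 t + c2 * v2 t).
Proof.
  intros H1 H2 t Ht; destruct (H1 t Ht) as [A1 B1]; destruct (H2 t Ht) as [A2 B2].
  split.
  - apply (is_derive_plus (fun t => c1 * u1 t)); now apply is_derive_scal.
  - replace (- p t * (c1 * v1 t + c2 * v2 t) - k t * (c1 * u1 t + c2 * u2 t))
      with (c1 * (- p t * v1 t - k t * u1 t) + c2 * (- p t * v2 t - k t * u2 t)) by ring.
    apply (is_derive_plus (fun t => c1 * v1 t)); now apply is_derive_scal.
Qed.

Lemma homogeneous_solution_subinterval (p k : R -> R) (a b a' b' : R) (u v : R -> R) :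
  a <= a' -> b' <= b ->
  homogeneous_solution p k a b u v -> homogeneous_solution p k a' b' u v.
Proof. intros Ha Hb H t Ht; apply H; lra. Qed.

Section Linear.

Variables (omega : R) (p k : R -> R).
Hypothesis homega : 0 < omega.
Hypotheses (hp : continuous_periodic omega p) (hk : continuous_periodic omega k).

Lemma linear_lipschitz : exists L, 0 <= L /\ forall t u v,
  Rabs (- p t * v - k t * u) <= L * (Rabs u + Rabs v).
Proof.
  destruct (continuous_periodic_bounded omega p homega hp) as [Mp [Hp0 Hp]].
  destruct (continuous_periodic_bounded omega k homega hk) as [Mk [Hk0 Hk]].
  exists (Mp + Mk); split; [lra|]; intros t u v.
  specialize (Hp t); specialize (Hk t).
  apply Rle_trans with (1 := Rabs_triang _ _).
  rewrite Rabs_Ropp, !Rabs_mult, Rabs_Ropp.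
  pose proof (Rabs_pos u); pose proof (Rabs_pos v).
  nra.
Qed.

(** The energy with H = 0 vanishes at [c], hence to its right by the forward bound and to its left
    by the backward one. *)
Lemma homogeneous_solution_unique (a b c : R) (u v : R -> R) : a <= c <= b ->
  homogeneous_solution p k a b u v -> u c = 0 -> v c = 0 ->
  forall t, a <= t <= b -> u t = 0 /\ v t = 0.
Proof.
  intros Hc Hs Hu Hv t Ht.
  destruct linear_lipschitz as [L [HL Hlip]].
  assert (HE : u t ^ 2 + v t ^ 2 + 0 ^ 2 <= 0).
  { assert (Hb : forall x y, a <= x -> y <= b -> x <= y ->
      u y ^ 2 + v y ^ 2 + 0 ^ 2 <= (u x ^ 2 + v x ^ 2 + 0 ^ 2) * exp ((2 + 3 * L) * (y - x)) /\
      u x ^ 2 + v x ^ 2 + 0 ^ 2 <= (u y ^ 2 + v y ^ 2 + 0 ^ 2) * exp ((2 + 3 * L) * (y - x))).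
    { intros x y Hx Hy Hxy.
      apply (energy_bounds u v (fun t => - p t * v t - k t * u t) x y L 0); try lra.
      - intros s Hs'; apply Hs; lra.
      - intros s Hs'; apply Hs; lra.
      - intros s _; rewrite Rplus_0_r; apply Hlip. }
    destruct (Rle_dec c t) as [Hct|Hct].
    - destruct (Hb c t) as [B _]; try lra; rewrite Hu, Hv in B; lra.
    - destruct (Hb t c) as [_ B]; try lra; rewrite Hu, Hv in B; lra. }
  pose proof (pow2_ge_0 (u t)); pose proof (pow2_ge_0 (v t)).
  split; apply Rsqr_0_uniq; unfold Rsqr; nra.
Qed.

Lemma fundamental_system : exists u1 v1 u2 v2 : R -> R,
  homogeneous_solution p k 0 omega u1 v1 /\ homogeneous_solution p k 0 omega u2 v2 /\
  u1 0 = 1 /\ v1 0 = 0 /\ u2 0 = 0 /\ v2 0 = 1.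
Proof.
  destruct linear_lipschitz as [L [HL Hlip]].
  assert (H1 : forall t u v u' v', Rabs (- p t * v - k t * u - (- p t * v' - k t * u'))
     <= L * (Rabs (u - u') + Rabs (v - v'))).
  { intros t u v u' v'.
    replace (- p t * v - k t * u - (- p t * v' - k t * u'))
      with (- p t * (v - v') - k t * (u - u')) by ring; apply Hlip. }
  assert (H2 : forall u v : R -> R,
    (forall t, continuous u t) -> (forall t, continuous v t) ->
    forall t, continuous (fun s => - p s * v s - k s * u s) t).
  { intros u v Hu Hv t; apply (continuous_minus (V := R_NormedModule)).
    - apply (continuous_mult (fun s => - p s) v); [|apply Hv].
      apply (continuous_opp (V := R_NormedModule)), hp.
    - apply (continuous_mult k u); [apply hk | apply Hu]. }
  assert (HS : forall u0 v0, exists u v, homogeneous_solution p k 0 omega u v /\ u 0 = u0 /\ v 0 = v0).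
  { intros u0 v0.
    destruct (initial_value_problem omega L (fun t u v => - p t * v - k t * u) homega HL H1 H2 u0 v0)
      as [[u v] [E1 [E2 [Hu [r [_ [Hr Er]]]]]]]; simpl in *.
    exists u, v; split; [|now split].
    intros t Ht; split; [apply Hu|]; rewrite <- Er by exact Ht; apply Hr. }
  destruct (HS 1 0) as [u1 [v1 [? []]]]; destruct (HS 0 1) as [u2 [v2 [? []]]].
  now exists u1, v1, u2, v2; repeat (split; [assumption|]).
Qed.

(** Uniqueness replaces Liouville's formula: a combination with zero data at [a] vanishes also at 0,
    where the initial data are its coefficients. *)
Lemma wronskian_neq_0 (u1 v1 u2 v2 : R -> R) (a : R) :
  homogeneous_solution p k 0 omega u1 v1 -> homogeneous_solution p k 0 omega u2 v2 ->
  u1 0 = 1 -> v1 0 = 0 -> u2 0 = 0 -> v2 0 = 1 -> 0 <= a <= omega ->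
  u1 a * v2 a - u2 a * v1 a <> 0.
Proof.
  intros H1 H2 E1 E2 E3 E4 Ha; apply nonsingular_2x2; intros x y Ex Ey.
  destruct (homogeneous_solution_unique 0 omega a
    (fun t => x * u1 t + y * u2 t) (fun t => x * v1 t + y * v2 t) Ha
    (homogeneous_solution_combination _ _ _ _ x y _ _ _ _ H1 H2)
    ltac:(lra) ltac:(lra) 0 ltac:(lra)) as [F1 F2].
  rewrite E1, E3 in F1; rewrite E2, E4 in F2; lra.
Qed.

End Linear.

(** * Regularity of the Green's function and estimates for its integrals *)

Section GreenFunction.

Variables (omega : R) (p k : R -> R) (G : R -> R -> R).
Hypothesis homega : 0 < omega.
Hypotheses (hp : continuous_periodic omega p) (hk : continuous_periodic omega k).
Hypothesis hG : is_periodic_Green_function omega p k G.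

Let cl := clamp 0 omega.
(** [G] is continuous only relative to the square. Clamping both arguments gives a function
    continuous on the plane with the same values on the square, which spares the boundary cases in
    integrals and limits. *)
Let Gc (t s : R) : R := G (cl t) (cl s).

Lemma clamped_time_in t : 0 <= cl t <= omega.
Proof. apply clamp_bounds; lra. Qed.

Lemma Gc_eq t s : 0 <= t <= omega -> 0 <= s <= omega -> Gc t s = G t s.
Proof. intros Ht Hs; unfold Gc, cl; now rewrite !clamp_id. Qed.

Lemma Gc_continuous_pair (z : R * R) : continuous (fun z => Gc (fst z) (snd z)) z.
Proof.
  set (ph := fun z : R * R => (cl (fst z), cl (snd z))).
  assert (Hin : forall z, period_square omega (ph z)) by (intros w; split; apply clamped_time_in).
  assert (Hph : continuous ph z).
  { apply filterlim_locally; intros eps.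
    assert (A1 : continuous (fun z : R * R => cl (fst z)) z)
      by (apply (continuous_comp fst cl); [apply continuous_fst | apply continuous_clamp]).
    assert (A2 : continuous (fun z : R * R => cl (snd z)) z)
      by (apply (continuous_comp snd cl); [apply continuous_snd | apply continuous_clamp]).
    pose proof (proj1 (filterlim_locally _ _) A1 eps) as B1.
    pose proof (proj1 (filterlim_locally _ _) A2 eps) as B2.
    generalize (filter_and _ _ B1 B2); apply filter_imp.
    intros w [C1 C2]; now split. }
  intros P HP.
  pose proof (proj1 hG (ph z) (Hin z) P HP) as HQ.
  pose proof (Hph _ HQ) as HR; unfold filtermap in *.
  revert HR; apply filter_imp; intros w Hw; apply (Hw (Hin w)).
Qed.

Lemma Gc_continuous_r t s : continuous (fun s => Gc t s) s.
Proof.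
  apply (continuous_comp_2 (fun _ => t) (fun s => s) Gc).
  - apply continuous_const.
  - apply continuous_id.
  - apply Gc_continuous_pair.
Qed.

Lemma Gc_continuous_l t s : continuous (fun t => Gc t s) t.
Proof.
  apply (continuous_comp_2 (fun t => t) (fun _ => s) Gc).
  - apply continuous_id.
  - apply continuous_const.
  - apply Gc_continuous_pair.
Qed.

Lemma Gc_mult_continuous t (h : R -> R) : (forall s, continuous h s) ->
  forall s, continuous (fun s => Gc t s * h s) s.
Proof.
  intros Hh s; apply (continuous_mult (fun s => Gc t s) h); [apply Gc_continuous_r | apply Hh].
Qed.

Lemma RInt_Gc t h : 0 <= t <= omega ->
  RInt (fun s => G t s * h s) 0 omega = RInt (fun s => Gc t s * h s) 0 omega.
Proof.
  intros Ht; apply RInt_ext; intros s; rewrite Rmin_left, Rmax_right by lra.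
  intros Hs; rewrite Gc_eq; [easy | exact Ht | lra].
Qed.

(* The integral solves the homogeneous equation on [a, b], so that it is
   determined linearly by two of its values. *)
Lemma Green_integral_interpolation (a b : R) : 0 < a -> a < b -> b < omega ->
  exists (t1 : R) (X Y : R -> R),
    a <= t1 <= b /\ (forall t, a <= t <= b -> ex_derive X t /\ ex_derive Y t) /\
    forall h, continuous_periodic omega h ->
      (forall t, a <= t <= b -> h t = 0) ->
      forall t, a <= t <= b ->
        RInt (fun s => G t s * h s) 0 omega
          = X t * RInt (fun s => G a s * h s) 0 omega
            + Y t * RInt (fun s => G t1 s * h s) 0 omega.
Proof.
  intros Ha Hab Hb.
  destruct (fundamental_system omega p k homega hp hk)
    as [u1 [v1 [u2 [v2 [S1 [S2 [E1 [E2 [E3 E4]]]]]]]]].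
  assert (HW : forall t, 0 <= t <= omega -> u1 t * v2 t - u2 t * v1 t <> 0)
    by (intros t Ht; now apply (wronskian_neq_0 omega p k homega hp hk)).
  assert (S1' := homogeneous_solution_subinterval p k 0 omega a b u1 v1 ltac:(lra) ltac:(lra) S1).
  assert (S2' := homogeneous_solution_subinterval p k 0 omega a b u2 v2 ltac:(lra) ltac:(lra) S2).
  (* This is the solution that vanishes at [a] and whose derivative there is the Wronskian. *)
  set (y := fun t => - u2 a * u1 t + u1 a * u2 t).
  set (y' := fun t => - u2 a * v1 t + u1 a * v2 t).
  assert (Sy : homogeneous_solution p k a b y y')
    by now apply homogeneous_solution_combination.
  (* If [y] vanished on [a, b], so would its derivative at the midpoint; by uniqueness y' would
     vanish at [a], where it equals the nonzero Wronskian. *)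
  assert (Ht1 : exists t1, a <= t1 <= b /\ y t1 <> 0).
  { apply Classical_Prop.NNPP; intros Hno.
    assert (Hy : forall t, a <= t <= b -> y t = 0).
    { intros t Ht; apply Classical_Prop.NNPP; intros Hne; apply Hno; now exists t. }
    set (c := (a + b) / 2).
    assert (Hc : a <= c <= b) by (unfold c; lra).
    assert (Hy'c : y' c = 0).
    { rewrite <- (is_derive_unique _ _ _ (proj1 (Sy c Hc))).
      apply is_derive_unique, (is_derive_ext_loc (fun _ => 0)); [|apply @is_derive_const].
      assert (Hr : 0 < (b - a) / 2) by lra.
      exists (mkposreal _ Hr); intros t Ht.
      change (Rabs (t - c) < (b - a) / 2) in Ht; apply Rabs_lt_between in Ht.
      unfold c in Ht; symmetry; apply Hy; lra. }
    destruct (homogeneous_solution_unique omega p k homega hp hk a b c y y' Hc Sy (Hy c Hc) Hy'c a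
                ltac:(lra)) as [_ Hy'a].
    apply (HW a ltac:(lra)); unfold y' in Hy'a; lra. }
  destruct Ht1 as [t1 [Ht1 Hy1]].
  (* The two solutions with values (1, 0) and (0, 1) at ([a], [t1]). They are chosen before [h], so
     a single formula serves every [h] vanishing on [a, b]. *)
  exists t1, (fun t => (u1 t * u2 t1 - u2 t * u1 t1) / y t1), (fun t => y t / y t1).
  split; [exact Ht1|]; split.
  - intros t Ht; destruct (S1' t Ht) as [D1 _]; destruct (S2' t Ht) as [D2 _].
    assert (ex_derive u1 t) by now exists (v1 t).
    assert (ex_derive u2 t) by now exists (v2 t).
    unfold y; split; auto_derive; repeat split; try assumption.
  - intros h Hh Hh0 t Ht.
    destruct (proj2 hG h Hh) as [[w1 [w2 [Hw _]]] _].
    set (w := (fun t => RInt (fun s => G t s * h s) 0 omega) : R -> R) in *.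
    assert (Sw : homogeneous_solution p k a b w w1).
    { intros s Hs.
      assert (Hs' : 0 <= s <= omega) by lra.
      destruct (Hw s Hs') as [D1 [D2 Eq]]; rewrite (Hh0 s Hs) in Eq; split.
      - apply (is_derive_of_D_in w w1 0 omega); [lra | exact D1].
      - replace (- p s * w1 s - k s * w s) with (w2 s)
          by (change (w2 s + p s * w1 s + k s * w s = 0) in Eq; lra).
        apply (is_derive_of_D_in w1 w2 0 omega); [lra | exact D2]. }
    pose proof (HW a ltac:(lra)) as Wa.
    set (W := u1 a * v2 a - u2 a * v1 a) in *.
    (* Cramer's rule: A u1 + B u2 has the value and the slope of [w] at [a]. *)
    set (A := (w a * v2 a - u2 a * w1 a) / W).
    set (B := (u1 a * w1 a - v1 a * w a) / W).
    assert (Hspan : forall s, a <= s <= b -> w s = A * u1 s + B * u2 s).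
    { intros s Hs.
      pose proof (homogeneous_solution_combination p k a b A B _ _ _ _ S1' S2') as Sc.
      pose proof (homogeneous_solution_combination p k a b 1 (-1) _ _ _ _ Sw Sc) as Sd.
      destruct (homogeneous_solution_unique omega p k homega hp hk a b a _ _ ltac:(lra) Sd) with (t := s)
        as [F _]; [| | exact Hs | simpl in F; lra].
      - unfold A, B, W; simpl; field; exact Wa.
      - unfold A, B, W; simpl; field; exact Wa. }
    change (w t = (u1 t * u2 t1 - u2 t * u1 t1) / y t1 * w a + y t / y t1 * w t1 :> R).
    rewrite (Hspan t Ht), (Hspan a ltac:(lra)), (Hspan t1 Ht1).
    unfold y in *; field; exact Hy1.
Qed.

(* Integrating against [h = Gam * bump], with [Gam] the defect of the interpolation
   formula for [G tau] and [bump] supported near [s], shows [Gam s = 0]. *)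
Lemma Green_differentiable (t s : R) : 0 < t < omega -> 0 < s < omega -> t <> s ->
  ex_derive (fun tau => G tau s) t.
Proof.
  intros Ht Hs Hts.
  pose proof (Rabs_pos_lt (t - s) ltac:(lra)) as Hd.
  (* Half of the distances keeps [t - eta, t + eta] inside (0, omega) and at distance at least [eta]
     from [s]. *)
  set (eta := Rmin (Rabs (t - s)) (Rmin t (omega - t)) / 2).
  assert (Heta : 0 < eta).
  { unfold eta; enough (0 < Rmin (Rabs (t - s)) (Rmin t (omega - t))) by lra.
    repeat apply Rmin_glb_lt; lra. }
  pose proof (Rmin_l (Rabs (t - s)) (Rmin t (omega - t))) as M1.
  pose proof (Rmin_r (Rabs (t - s)) (Rmin t (omega - t))) as M2.
  pose proof (Rmin_l t (omega - t)) as M3; pose proof (Rmin_r t (omega - t)) as M4.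
  assert (Heta1 : 2 * eta <= Rabs (t - s)) by (unfold eta; lra).
  assert (Heta2 : 2 * eta <= t) by (unfold eta; lra).
  assert (Heta3 : 2 * eta <= omega - t) by (unfold eta; lra).
  clear M1 M2 M3 M4; clearbody eta.
  destruct (Green_integral_interpolation (t - eta) (t + eta)) as [t1 [X [Y [Ht1 [HXY Hint]]]]];
    try lra.
  (* The bump of radius [zeta] around [s] vanishes on [t - eta, t + eta], where the test function
     must be zero, and at 0 and omega, which permits its periodic extension. *)
  set (zeta := Rmin eta (Rmin s (omega - s))).
  assert (Hz : 0 < zeta) by (repeat apply Rmin_glb_lt; lra).
  assert (Hz1 : zeta <= eta) by apply Rmin_l.
  assert (Hz2 : zeta <= s) by (eapply Rle_trans; [apply Rmin_r | apply Rmin_l]).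
  assert (Hz3 : zeta <= omega - s) by (eapply Rle_trans; [apply Rmin_r | apply Rmin_r]).
  clearbody zeta.
  set (bump := fun x => Rmax 0 (zeta - Rabs (x - s))).
  assert (Hbc : forall x, continuous bump x).
  { apply (continuous_of_lipschitz _ 1); intros x x'; unfold bump, Rmax, Rabs.
    repeat destruct (Rle_dec _ _); repeat destruct (Rcase_abs _); lra. }
  assert (Hb0 : forall x, zeta <= Rabs (x - s) -> bump x = 0)
    by (intros x Hx; unfold bump; apply Rmax_left; lra).
  assert (Hloc : forall tau, t - eta <= tau <= t + eta ->
    G tau s = X tau * G (t - eta) s + Y tau * G t1 s).
  { intros tau Htau.
    set (Gam := fun x => Gc tau x - (X tau * Gc (t - eta) x + Y tau * Gc t1 x)).
    assert (HGam : forall x, continuous Gam x).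
    { intros x; apply (continuous_minus (V := R_NormedModule)); [apply Gc_continuous_r|].
      apply (continuous_plus (V := R_NormedModule));
        apply (continuous_scal_r (V := R_NormedModule)), Gc_continuous_r. }
    assert (HGb : forall x, continuous (fun x => Gam x * bump x) x)
      by (intros x; apply (continuous_mult Gam bump); auto).
    destruct (periodic_extension omega (fun x => Gam x * bump x) homega HGb) as [h [Hh Eh]].
    { rewrite !Hb0; [ring | rewrite Rabs_pos_eq; lra |].
      rewrite Rabs_minus_sym, Rabs_pos_eq; lra. }
    assert (Hzero : RInt (fun x => Gam x * h x) 0 omega = 0).
    { pose proof (Hint h Hh) as E; specialize (E) with (2 := Htau).
      rewrite !RInt_Gc in E by lra.
      assert (I : forall r, ex_RInt (fun x => Gc r x * h x) 0 omega)
        by (intros r; apply ex_RInt_of_continuous, Gc_mult_continuous, Hh).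
      assert (J : RInt (fun x => Gam x * h x) 0 omega
        = RInt (fun x => Gc tau x * h x) 0 omega
          - (X tau * RInt (fun x => Gc (t - eta) x * h x) 0 omega
             + Y tau * RInt (fun x => Gc t1 x * h x) 0 omega)).
      { apply is_RInt_unique.
        apply (is_RInt_ext (fun x => minus (Gc tau x * h x)
          (plus (scal (X tau) (Gc (t - eta) x * h x)) (scal (Y tau) (Gc t1 x * h x))))).
        { intros x _; unfold Gam; rewrite Rmult_minus_distr_r, Rmult_plus_distr_r, !Rmult_assoc; easy. }
        apply (is_RInt_minus (V := R_NormedModule)).
        - now apply (RInt_correct (V := R_CompleteNormedModule)).
        - apply (is_RInt_plus (V := R_NormedModule));
            apply (is_RInt_scal (V := R_NormedModule));
            now apply (RInt_correct (V := R_CompleteNormedModule)). }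
      rewrite J, E; [apply Rminus_diag|].
      intros x Hx; rewrite Eh by lra; rewrite Hb0; [ring|].
      assert (A1 : Rabs (x - t) <= eta) by (apply Rabs_le_between; lra).
      pose proof (Rabs_triang (t - x) (x - s)) as A2.
      replace (t - x + (x - s)) with (t - s) in A2 by ring.
      rewrite (Rabs_minus_sym t x) in A2; lra. }
    assert (HGs : Gam s * (Gam s * bump s) = 0).
    { apply (nonneg_integral_zero (fun x => Gam x * (Gam x * bump x)) 0 omega s Hs).
      - intros x; apply (continuous_mult Gam (fun x => Gam x * bump x)); auto.
      - intros x _; rewrite <- Rmult_assoc; apply Rmult_le_pos; [apply Rle_0_sqr | apply Rmax_l].
      - apply (eq_trans (y := RInt (fun x => Gam x * h x) 0 omega)); [|exact Hzero].
        apply RInt_ext; intros x; rewrite Rmin_left, Rmax_right by lra.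
        intros Hx; rewrite Eh by lra; easy. }
    assert (Hbs : bump s = zeta)
      by (unfold bump; rewrite Rminus_diag, Rabs_R0, Rmax_right; lra).
    rewrite Hbs in HGs.
    assert (HG0 : Gam s = 0) by (apply Rsqr_0_uniq; unfold Rsqr; nra).
    unfold Gam in HG0; rewrite !Gc_eq in HG0 by lra; lra. }
  destruct (HXY t ltac:(lra)) as [DX DY].
  apply (ex_derive_ext_loc (fun tau => X tau * G (t - eta) s + Y tau * G t1 s)).
  - exists (mkposreal _ Heta); intros tau Htau.
    change (Rabs (tau - t) < eta) in Htau; apply Rabs_lt_between in Htau.
    symmetry; apply Hloc; lra.
  - auto_derive; now repeat split.
Qed.

Lemma Green_integral_bounds (lo hi t : R) (h : R -> R) :
  (forall s, 0 <= s <= omega -> lo <= G t s <= hi) -> 0 <= t <= omega ->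
  (forall s, continuous h s) -> (forall s, 0 <= s <= omega -> 0 <= h s) ->
  lo * RInt h 0 omega <= RInt (fun s => G t s * h s) 0 omega <= hi * RInt h 0 omega.
Proof.
  intros Hb Ht Hc Hpos; rewrite RInt_Gc by exact Ht.
  assert (E : forall c, c * RInt h 0 omega = RInt (fun s => c * h s) 0 omega)
    by (intros c; symmetry;
        apply (RInt_scal (V := R_CompleteNormedModule)), ex_RInt_of_continuous, Hc).
  assert (I : forall c, ex_RInt (fun s => c * h s) 0 omega)
    by (intros c; apply ex_RInt_of_continuous; intros s;
        apply (continuous_scal_r (V := R_NormedModule)), Hc).
  assert (J : ex_RInt (fun s => Gc t s * h s) 0 omega)
    by (apply ex_RInt_of_continuous, Gc_mult_continuous, Hc).
  rewrite !E; split; (apply RInt_le; [lra | auto | auto |]);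
    intros s Hs; (apply Rmult_le_compat_r; [apply Hpos; lra|]);
    rewrite Gc_eq by lra; apply Hb; lra.
Qed.

Variable D : R.
Hypothesis hD : is_lub (Green_derivative_values omega G) D.

Lemma Green_derive_le (t s : R) : 0 < t < omega -> 0 < s < omega -> t <> s ->
  Rabs (Derive (fun tau => G tau s) t) <= D.
Proof.
  intros Ht Hs Hts; apply hD.
  exists t, s, (Derive (fun tau => G tau s) t).
  unfold period_interval; repeat split; try lra.
  apply D_in_of_is_derive, Derive_correct, Green_differentiable; assumption.
Qed.

Lemma Green_derive_bound_nonneg : 0 <= D.
Proof.
  apply Rle_trans with (2 := Green_derive_le (omega / 3) (omega / 2)
    ltac:(lra) ltac:(lra) ltac:(lra)), Rabs_pos.
Qed.

Lemma Gc_lipschitz_off_diagonal (s a b : R) : 0 < s < omega ->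
  0 <= a -> a <= b -> b <= omega -> s <= a \/ b <= s ->
  Rabs (Gc b s - Gc a s) <= D * (b - a).
Proof.
  intros Hs Ha Hab Hb Hsab.
  pose proof Green_derive_bound_nonneg as HD.
  (* The mean value theorem may return an endpoint, where the derivative is not controlled. The
     clamped candidate is the true derivative at interior points and is bounded by [D]
     everywhere. *)
  destruct (MVT_gen (fun t => Gc t s) a b
    (fun t => clamp (- D) D (Derive (fun tau => G tau s) t))) as [c [Hc E]];
    rewrite ?Rmin_left, ?Rmax_right in * by exact Hab.
  - intros t Ht.
    rewrite clamp_id by (apply Rabs_le_between, Green_derive_le; lra).
    apply (is_derive_ext_loc (fun tau => G tau s)).
    + assert (Hr : 0 < Rmin (t - a) (b - t)) by (apply Rmin_glb_lt; lra).
      exists (mkposreal _ Hr); intros tau Htau.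
      change (Rabs (tau - t) < Rmin (t - a) (b - t)) in Htau.
      pose proof (Rmin_l (t - a) (b - t)); pose proof (Rmin_r (t - a) (b - t)).
      apply Rabs_lt_between in Htau; symmetry; apply Gc_eq; lra.
    + apply Derive_correct, Green_differentiable; lra.
  - intros t _; apply continuity_pt_filterlim, Gc_continuous_l.
  - rewrite E, Rabs_mult, (Rabs_pos_eq (b - a)) by lra.
    apply Rmult_le_compat_r; [lra|].
    apply Rabs_le_between, clamp_bounds; lra.
Qed.

(** An interval that crosses the diagonal is split at [s]: by continuity of G the jump of dG/dt
    there leaves the Lipschitz constant unchanged. *)
Lemma Gc_lipschitz (s a b : R) : 0 < s < omega -> 0 <= a <= omega -> 0 <= b <= omega ->
  Rabs (Gc b s - Gc a s) <= D * Rabs (b - a).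
Proof.
  intros Hs; revert a b.
  assert (H : forall a b, 0 <= a -> a <= b -> b <= omega ->
    Rabs (Gc b s - Gc a s) <= D * (b - a)).
  { intros a b Ha Hab Hb.
    destruct (Rle_dec s a) as [H1|H1]; [now apply Gc_lipschitz_off_diagonal; auto|].
    destruct (Rle_dec b s) as [H2|H2]; [now apply Gc_lipschitz_off_diagonal; auto|].
    replace (Gc b s - Gc a s) with ((Gc b s - Gc s s) + (Gc s s - Gc a s)) by ring.
    apply Rle_trans with (1 := Rabs_triang _ _).
    pose proof (Gc_lipschitz_off_diagonal s s b Hs ltac:(lra) ltac:(lra) Hb ltac:(lra)).
    pose proof (Gc_lipschitz_off_diagonal s a s Hs Ha ltac:(lra) ltac:(lra) ltac:(lra)).
    lra. }
  intros a b Ha Hb; destruct (Rle_dec a b) as [Hab|Hab].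
  - rewrite (Rabs_pos_eq (b - a)) by lra; apply H; lra.
  - rewrite Rabs_minus_sym, (Rabs_minus_sym b a), (Rabs_pos_eq (a - b)) by lra; apply H; lra.
Qed.

(** The Lipschitz bound on G passes under the integral, so no differentiation under the integral
    sign across the jump of dG/dt is involved. *)
Lemma Green_integral_derivative_bound (h z : R -> R) (t l : R) :
  (forall s, continuous h s) -> (forall s, 0 <= s <= omega -> 0 <= h s) ->
  (forall t, 0 <= t <= omega -> z t = RInt (fun s => G t s * h s) 0 omega) ->
  0 <= t <= omega -> is_derive z t l ->
  Rabs l <= D * RInt h 0 omega.
Proof.
  intros Hc Hpos Hz Ht Hl.
  apply (derivative_le_lipschitz z 0 omega t l); try assumption.
  intros x y Hx Hy; rewrite !Hz, !RInt_Gc by assumption.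
  replace (D * RInt h 0 omega * Rabs (x - y)) with
    (RInt (fun s => D * Rabs (x - y) * h s) 0 omega).
  2: { apply (eq_trans (y := D * Rabs (x - y) * RInt h 0 omega));
         [|rewrite Rmult_assoc, (Rmult_comm (Rabs _)), <- Rmult_assoc; reflexivity].
       apply (RInt_scal (V := R_CompleteNormedModule)), ex_RInt_of_continuous, Hc. }
  assert (I : forall r, ex_RInt (fun s => Gc r s * h s) 0 omega)
    by (intros r; apply ex_RInt_of_continuous, Gc_mult_continuous, Hc).
  replace (RInt (fun s => Gc x s * h s) 0 omega - RInt (fun s => Gc y s * h s) 0 omega)
    with (RInt (fun s => Gc x s * h s - Gc y s * h s) 0 omega)
    by (apply (RInt_minus (V := R_CompleteNormedModule)); apply I).
  assert (J : forall s, continuous (fun s => Gc x s * h s - Gc y s * h s) s)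
    by (intros s; apply (continuous_minus (V := R_NormedModule)); now apply Gc_mult_continuous).
  apply Rle_trans with (RInt (fun s => Rabs (Gc x s * h s - Gc y s * h s)) 0 omega).
  - apply abs_RInt_le; [lra | now apply ex_RInt_of_continuous].
  - apply RInt_le; [lra | | |].
    + apply ex_RInt_of_continuous; intros s.
      apply continuous_comp; [apply J | apply continuous_Rabs].
    + apply ex_RInt_of_continuous; intros s.
      apply (continuous_scal_r (V := R_NormedModule)), Hc.
    + intros s Hs; rewrite <- Rmult_minus_distr_r, Rabs_mult, (Rabs_pos_eq (h s)) by (apply Hpos; lra).
      apply Rmult_le_compat_r; [apply Hpos; lra|].
      apply Gc_lipschitz; lra.
Qed.

End GreenFunction.

(** * Periodic solutions with a bounded nonlinearity *)

Definition lipschitz2 (f : R -> R -> R) : Prop :=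
  exists Lam, 0 <= Lam /\ forall x y x' y',
    Rabs (f x y - f x' y') <= Lam * (Rabs (x - x') + Rabs (y - y')).

Lemma lipschitz2_lin (a b : R) (f g : R -> R -> R) :
  lipschitz2 f -> lipschitz2 g -> lipschitz2 (fun x y => a * f x y + b * g x y).
Proof.
  intros [Lf [Hf0 Hf]] [Lg [Hg0 Hg]].
  pose proof (Rabs_pos a); pose proof (Rabs_pos b).
  exists (Rabs a * Lf + Rabs b * Lg); split; [nra|].
  intros x y x' y'; specialize (Hf x y x' y'); specialize (Hg x y x' y').
  replace (a * f x y + b * g x y - (a * f x' y' + b * g x' y'))
    with (a * (f x y - f x' y') + b * (g x y - g x' y')) by ring.
  apply Rle_trans with (1 := Rabs_triang _ _); rewrite !Rabs_mult.
  apply (Rmult_le_compat_l _ _ _ (Rabs_pos a)) in Hf.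
  apply (Rmult_le_compat_l _ _ _ (Rabs_pos b)) in Hg.
  lra.
Qed.

Lemma lipschitz2_fst : lipschitz2 (fun x _ => x).
Proof.
  exists 1; split; [lra|]; intros x y x' y'.
  pose proof (Rabs_pos (y - y')); lra.
Qed.

Lemma lipschitz2_snd : lipschitz2 (fun _ y => y).
Proof.
  exists 1; split; [lra|]; intros x y x' y'.
  pose proof (Rabs_pos (x - x')); lra.
Qed.

(** Inverting the matrix turns the system into (x, y) = (N1, N2) with N1 and N2 bounded by K1 and
    K2. On the boundary of a square of half-side K1 + K2 + 1 the signs of x - N1 and y - N2 are
    those of x and y. *)
Lemma bounded_perturbation_zero (a b c d C : R) (B1 B2 : R -> R -> R) :
  a * d - b * c <> 0 ->
  lipschitz2 B1 -> lipschitz2 B2 ->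
  (forall x y, Rabs (B1 x y) <= C) -> (forall x y, Rabs (B2 x y) <= C) ->
  exists x y, a * x + b * y = B1 x y /\ c * x + d * y = B2 x y.
Proof.
  intros Hdet L1 L2 C1 C2.
  set (det := a * d - b * c) in *.
  set (N1 := fun x y => d / det * B1 x y + - b / det * B2 x y).
  set (N2 := fun x y => - c / det * B1 x y + a / det * B2 x y).
  assert (HN : forall e1 e2 x y, Rabs (e1 * B1 x y + e2 * B2 x y) <= (Rabs e1 + Rabs e2) * C).
  { intros e1 e2 x y; apply Rle_trans with (1 := Rabs_triang _ _).
    rewrite !Rabs_mult; specialize (C1 x y); specialize (C2 x y).
    pose proof (Rabs_pos e1); pose proof (Rabs_pos e2); nra. }
  set (K1 := (Rabs (d / det) + Rabs (- b / det)) * C).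
  set (K2 := (Rabs (- c / det) + Rabs (a / det)) * C).
  assert (HK1 : forall x y, Rabs (N1 x y) <= K1) by (intros; apply HN).
  assert (HK2 : forall x y, Rabs (N2 x y) <= K2) by (intros; apply HN).
  assert (0 <= K1) by (apply Rle_trans with (2 := HK1 0 0), Rabs_pos).
  assert (0 <= K2) by (apply Rle_trans with (2 := HK2 0 0), Rabs_pos).
  destruct (lipschitz2_lin 1 (-1) _ N1 lipschitz2_fst (lipschitz2_lin _ _ _ _ L1 L2))
    as [M1 [HM1 P1]].
  destruct (lipschitz2_lin 1 (-1) _ N2 lipschitz2_snd (lipschitz2_lin _ _ _ _ L1 L2))
    as [M2 [HM2 P2]].
  destruct (poincare_miranda (K1 + K2 + 1) (M1 + M2)
    (fun x y => 1 * x + -1 * N1 x y) (fun x y => 1 * y + -1 * N2 x y)) as [x [y [E1 E2]]].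
  - lra.
  - intros x y x' y'; apply Rle_trans with (1 := P1 x y x' y').
    apply Rmult_le_compat_r; [|lra].
    apply Rplus_le_le_0_compat; apply Rabs_pos.
  - intros x y x' y'; apply Rle_trans with (1 := P2 x y x' y').
    apply Rmult_le_compat_r; [|lra].
    apply Rplus_le_le_0_compat; apply Rabs_pos.
  - intros y; pose proof (HK1 (- (K1 + K2 + 1)) y) as B; pose proof (HK1 (K1 + K2 + 1) y) as B'.
    apply Rabs_le_between in B; apply Rabs_le_between in B'; lra.
  - intros x; pose proof (HK2 x (- (K1 + K2 + 1))) as B; pose proof (HK2 x (K1 + K2 + 1)) as B'.
    apply Rabs_le_between in B; apply Rabs_le_between in B'; lra.
  - exists x, y.
    assert (Ex : x = N1 x y) by lra; assert (Ey : y = N2 x y) by lra.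
    unfold N1 in Ex; unfold N2 in Ey.
    set (b1 := B1 x y) in *; set (b2 := B2 x y) in *.
    rewrite Ex, Ey; unfold det in *; split; field; exact Hdet.
Qed.

(** Since exp c >= 1, the root A exp(c/2) may be enlarged to A exp c, which avoids square roots. *)
Lemma abs_le_of_energy (x y A c : R) : 0 <= A -> 0 <= c ->
  x ^ 2 + y ^ 2 <= A ^ 2 * exp c -> Rabs x <= A * exp c /\ Rabs y <= A * exp c.
Proof.
  intros HA Hc HE.
  assert (H1 : 1 <= exp c) by (pose proof (exp_ineq1_le c); lra).
  assert (HAe : 0 <= A * exp c) by (apply Rmult_le_pos; lra).
  assert (HE2 : A ^ 2 * exp c <= (A * exp c) ^ 2).
  { rewrite Rpow_mult_distr; apply Rmult_le_compat_l; [apply pow2_ge_0 | nra]. }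
  pose proof (pow2_ge_0 x); pose proof (pow2_ge_0 y).
  rewrite <- (Rabs_pos_eq (A * exp c)) by exact HAe.
  split; apply Rsqr_le_abs_0; rewrite !Rsqr_pow2; lra.
Qed.

Section BoundedNonlinearity.

Variables (omega : R) (p k : R -> R) (G : R -> R -> R).
Hypothesis homega : 0 < omega.
Hypotheses (hp : continuous_periodic omega p) (hk : continuous_periodic omega k).
Hypothesis hG : is_periodic_Green_function omega p k G.

(** The uniqueness clause for h = 0 gives u = 0 on [0, omega]. The derivative is read off at the
    midpoint, where these values determine it, and zero data at the midpoint propagate back to 0. *)
Lemma periodic_homogeneous_trivial (u v : R -> R) :
  homogeneous_solution p k 0 omega u v -> u 0 = u omega -> v 0 = v omega ->
  u 0 = 0 /\ v 0 = 0.
Proof.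
  intros Hs Eu Ev.
  assert (Hz : continuous_periodic omega (fun _ => 0))
    by (split; [intros t; apply continuous_const | easy]).
  assert (Hu : forall t, 0 <= t <= omega -> u t = 0).
  { intros t Ht; rewrite (proj2 (proj2 hG (fun _ => 0) Hz) u); [| |exact Ht].
    - rewrite (RInt_ext _ (fun _ => 0)) by (intros; apply Rmult_0_r).
      rewrite RInt_const; apply Rmult_0_r.
    - exists v, (fun t => - p t * v t - k t * u t); split; [|now split].
      intros s Hs'; destruct (Hs s Hs') as [D1 D2].
      split; [|split]; [now apply D_in_of_is_derive .. | ring]. }
  apply (homogeneous_solution_unique omega p k homega hp hk 0 omega (omega / 2) u v);
    try lra; try assumption; [apply Hu; lra|].
  rewrite <- (is_derive_unique _ _ _ (proj1 (Hs (omega / 2) ltac:(lra)))).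
  apply is_derive_unique, (is_derive_ext_loc (fun _ => 0)); [|apply @is_derive_const].
  assert (Hr : 0 < omega / 2) by lra.
  exists (mkposreal _ Hr); intros t Ht.
  change (Rabs (t - omega / 2) < omega / 2) in Ht; apply Rabs_lt_between in Ht.
  symmetry; apply Hu; lra.
Qed.

Variables (f : R -> R -> R -> R) (Lf H : R).
Hypothesis hLf : 0 <= Lf.
Hypothesis hf_lip : forall t u v u' v',
  Rabs (f t u v - f t u' v') <= Lf * (Rabs (u - u') + Rabs (v - v')).
Hypothesis hf_cont : forall u v : R -> R,
  (forall t, continuous u t) -> (forall t, continuous v t) ->
  forall t, continuous (fun s => f s (u s) (v s)) t.
Hypothesis hf_bound : forall t u v, Rabs (f t u v) <= H.
Hypothesis hf_periodic : forall t u v, f (t + omega) u v = f t u v.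

Theorem bounded_nonlinearity_periodic_solution : exists u v r : R -> R,
  (forall t, is_derive u t (v t)) /\ (forall t, is_derive v t (r t)) /\
  (forall t, continuous r t) /\
  u 0 = u omega /\ v 0 = v omega /\ r 0 = r omega /\
  forall t, 0 <= t <= omega ->
    r t + p t * v t + k t * u t = f t (u t) (v t) /\
    u t = RInt (fun s => G t s * f s (u s) (v s)) 0 omega.
Proof.
  destruct (linear_lipschitz omega p k homega hp hk) as [L [HL Hlip]].
  set (g := fun t u v => f t u v + (- p t * v - k t * u)).
  assert (Hg1 : forall t u v u' v', Rabs (g t u v - g t u' v')
     <= (Lf + L) * (Rabs (u - u') + Rabs (v - v'))).
  { intros t u v u' v'; unfold g.
    replace (f t u v + (- p t * v - k t * u) - (f t u' v' + (- p t * v' - k t * u')))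
      with ((f t u v - f t u' v') + (- p t * (v - v') - k t * (u - u'))) by ring.
    apply Rle_trans with (1 := Rabs_triang _ _).
    rewrite Rmult_plus_distr_r; apply Rplus_le_compat; [apply hf_lip | apply Hlip]. }
  assert (Hg2 : forall u v : R -> R,
    (forall t, continuous u t) -> (forall t, continuous v t) ->
    forall t, continuous (fun s => g s (u s) (v s)) t).
  { intros u v Hu Hv t; apply (continuous_plus (V := R_NormedModule)); [now apply hf_cont|].
    apply (continuous_minus (V := R_NormedModule)).
    - apply (continuous_mult (fun s => - p s) v); [|apply Hv].
      apply (continuous_opp (V := R_NormedModule)), hp.
    - apply (continuous_mult k u); [apply hk | apply Hu]. }
  set (S := fun x y => initial_value_problem omega (Lf + L) g homega ltac:(lra) Hg1 Hg2 x y).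
  set (U := fun x y => fst (proj1_sig (S x y))).
  set (V := fun x y => snd (proj1_sig (S x y))).
  assert (HS : forall x y, U x y 0 = x /\ V x y 0 = y /\
    (forall t, is_derive (U x y) t (V x y t)) /\
    exists r : R -> R,
      (forall t, continuous r t) /\ (forall t, is_derive (V x y) t (r t)) /\
      forall t, 0 <= t <= omega -> r t = g t (U x y t) (V x y t))
    by (intros x y; exact (proj2_sig (S x y))).
  clearbody U V; clear S.
  destruct (fundamental_system omega p k homega hp hk)
    as [u1 [v1 [u2 [v2 [S1 [S2 [E1 [E2 [E3 E4]]]]]]]]].
  assert (HH : 0 <= H) by (apply Rle_trans with (2 := hf_bound 0 0 0), Rabs_pos).
  (* The difference of two solutions has no source term, so the energy estimate with H = 0 gives a
     Lipschitz shooting map. *)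
  assert (Hstab : exists Lam, 0 <= Lam /\ forall x y x' y',
    Rabs (U x y omega - U x' y' omega) <= Lam * (Rabs (x - x') + Rabs (y - y')) /\
    Rabs (V x y omega - V x' y' omega) <= Lam * (Rabs (x - x') + Rabs (y - y'))).
  { exists (exp ((2 + 3 * (Lf + L)) * (omega - 0))); split; [left; apply exp_pos|].
    intros x y x' y'.
    destruct (HS x y) as [Ux [Vx [DU [r [_ [DV Er]]]]]].
    destruct (HS x' y') as [Ux' [Vx' [DU' [r' [_ [DV' Er']]]]]].
    destruct (energy_bounds (fun t => U x y t - U x' y' t) (fun t => V x y t - V x' y' t)
      (fun t => r t - r' t) 0 omega (Lf + L) 0) as [B _]; try lra.
    - intros t _; apply (is_derive_minus (U x y) (U x' y')); auto.
    - intros t _; apply (is_derive_minus (V x y) (V x' y')); auto.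
    - intros t Ht; rewrite Er, Er', Rplus_0_r by exact Ht; apply Hg1.
    - rewrite Ux, Ux', Vx, Vx' in B.
      set (c := exp ((2 + 3 * (Lf + L)) * (omega - 0))) in *.
      pose proof (Rabs_pos (x - x')); pose proof (Rabs_pos (y - y')).
      rewrite (Rmult_comm c).
      apply abs_le_of_energy; [lra | apply Rmult_le_pos; lra |].
      fold c; apply Rle_trans with (((x - x') ^ 2 + (y - y') ^ 2 + 0 ^ 2) * c); [lra|].
      apply Rmult_le_compat_r; [left; apply exp_pos|].
      rewrite <- (pow2_abs (x - x')), <- (pow2_abs (y - y')); nra. }
  (* The difference from the linear flow with the same data starts at zero and is driven by [f]
     alone; the energy estimate bounds it uniformly in the data. *)
  assert (Hbd : exists C, forall x y,
    Rabs (U x y omega - (x * u1 omega + y * u2 omega)) <= C /\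
    Rabs (V x y omega - (x * v1 omega + y * v2 omega)) <= C).
  { exists (H * exp ((2 + 3 * L) * (omega - 0))); intros x y.
    destruct (HS x y) as [Ux [Vx [DU [r [_ [DV Er]]]]]].
    pose proof (homogeneous_solution_combination p k 0 omega x y _ _ _ _ S1 S2) as Sc.
    destruct (energy_bounds (fun t => U x y t - (x * u1 t + y * u2 t))
      (fun t => V x y t - (x * v1 t + y * v2 t))
      (fun t => r t - (- p t * (x * v1 t + y * v2 t) - k t * (x * u1 t + y * u2 t)))
      0 omega L H) as [B _]; try lra.
    - intros t Ht; apply (is_derive_minus (U x y)); [apply DU | apply (Sc t Ht)].
    - intros t Ht; apply (is_derive_minus (V x y)); [apply DV | apply (Sc t Ht)].
    - intros t Ht; rewrite Er by exact Ht; unfold g.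
      match goal with |- Rabs ?e <= L * (Rabs ?a + Rabs ?b) + H =>
        replace e with ((- p t * b - k t * a) + f t (U x y t) (V x y t)) by ring end.
      apply Rle_trans with (1 := Rabs_triang _ _).
      apply Rplus_le_compat; [apply Hlip | apply hf_bound].
    - rewrite Ux, Vx, E1, E2, E3, E4 in B.
      replace ((x - (x * 1 + y * 0)) ^ 2 + (y - (x * 0 + y * 1)) ^ 2 + H ^ 2)
        with (H ^ 2) in B by ring.
      apply abs_le_of_energy; [exact HH | apply Rmult_le_pos; lra |].
      apply Rle_trans with (2 := B); pose proof (pow2_ge_0 H); lra. }
  destruct Hstab as [Lam [HLam Hstab]]; destruct Hbd as [C HC].
  (* The matrix is the identity minus the monodromy matrix, whose kernel consists of the data of
     periodic homogeneous solutions. *)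
  destruct (bounded_perturbation_zero (1 - u1 omega) (- u2 omega) (- v1 omega) (1 - v2 omega) C
    (fun x y => U x y omega - (x * u1 omega + y * u2 omega))
    (fun x y => V x y omega - (x * v1 omega + y * v2 omega))) as [x [y [Ex Ey]]].
  - apply nonsingular_2x2; intros x y Ex Ey.
    destruct (periodic_homogeneous_trivial _ _
      (homogeneous_solution_combination p k 0 omega x y _ _ _ _ S1 S2)) as [F1 F2].
    + rewrite E1, E3; lra.
    + rewrite E2, E4; lra.
    + rewrite E1, E3 in F1; rewrite E2, E4 in F2; lra.
  - assert (LU : lipschitz2 (fun x y => U x y omega))
      by (exists Lam; split; [exact HLam | apply Hstab]).
    destruct (lipschitz2_lin 1 (-1) _ _ LU
      (lipschitz2_lin (u1 omega) (u2 omega) _ _ lipschitz2_fst lipschitz2_snd)) as [M [HM P]].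
    exists M; split; [exact HM|]; intros x y x' y'.
    apply Rle_trans with (2 := P x y x' y'); right; f_equal; ring.
  - assert (LV : lipschitz2 (fun x y => V x y omega))
      by (exists Lam; split; [exact HLam | apply Hstab]).
    destruct (lipschitz2_lin 1 (-1) _ _ LV
      (lipschitz2_lin (v1 omega) (v2 omega) _ _ lipschitz2_fst lipschitz2_snd)) as [M [HM P]].
    exists M; split; [exact HM|]; intros x y x' y'.
    apply Rle_trans with (2 := P x y x' y'); right; f_equal; ring.
  - intros x y; apply HC.
  - intros x y; apply HC.
  - destruct (HS x y) as [Ux [Vx [DU [r [Cr [DV Er]]]]]].
    set (u := U x y) in *; set (v := V x y) in *.
    assert (Pu : u 0 = u omega) by lra.
    assert (Pv : v 0 = v omega) by lra.
    assert (Pf : forall a b, f 0 a b = f omega a b)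
      by (intros a b; rewrite <- (hf_periodic 0), Rplus_0_l; reflexivity).
    assert (Pp : p 0 = p omega) by (rewrite <- (proj2 hp 0), Rplus_0_l; reflexivity).
    assert (Pk : k 0 = k omega) by (rewrite <- (proj2 hk 0), Rplus_0_l; reflexivity).
    assert (Pr : r 0 = r omega)
      by (rewrite !Er by lra; unfold g; rewrite Pf, Pu, Pv, Pp, Pk; reflexivity).
    exists u, v, r; do 6 (split; [assumption|]).
    assert (Eq : forall t, 0 <= t <= omega -> r t + p t * v t + k t * u t = f t (u t) (v t))
      by (intros t Ht; rewrite Er by exact Ht; unfold g; ring).
    intros t Ht; split; [now apply Eq|].
    assert (Cf : forall s, continuous (fun s => f s (u s) (v s)) s)
      by (apply hf_cont; [apply (continuous_of_is_derive u v DU) | apply (continuous_of_is_derive v r DV)]).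
    destruct (periodic_extension omega (fun s => f s (u s) (v s)) homega Cf) as [h [Hh Eh]].
    { now rewrite Pf, Pu, Pv. }
    rewrite (proj2 (proj2 hG h Hh) u); [| |exact Ht].
    + apply RInt_ext; intros s; rewrite Rmin_left, Rmax_right by lra.
      intros Hs; rewrite Eh; [reflexivity | lra].
    + exists v, r; split; [|now split].
      intros s Hs; split; [|split].
      * now apply D_in_of_is_derive.
      * now apply D_in_of_is_derive.
      * rewrite Eh by exact Hs; now apply Eq.
Qed.

End BoundedNonlinearity.

(** F(t + omega) - F(t) has zero derivative, and at t = 0 it is the integral of [f] over one
    period. *)
Lemma periodic_primitive (omega c : R) (f : R -> R) : 0 < omega ->
  continuous_periodic omega f -> RInt f 0 omega = 0 ->
  continuous_periodic omega (fun t => c + RInt f 0 t) /\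
  forall t, is_derive (fun t => c + RInt f 0 t) t (f t).
Proof.
  intros Hom [Hc Hp] H0.
  assert (Hd : forall t, is_derive (fun t => c + RInt f 0 t) t (f t)).
  { intros t; rewrite <- (Rplus_0_l (f t)).
    apply (is_derive_plus (fun _ => c)); [apply @is_derive_const|].
    now apply is_derive_RInt_of_continuous. }
  split; [split|exact Hd].
  - exact (continuous_of_is_derive _ _ Hd).
  - intros t.
    set (F := fun t => c + RInt f 0 t) in *.
    assert (Hs : forall s, is_derive (fun s => F (s + omega) - F s) s zero).
    { intros s; change (is_derive (fun s => F (s + omega) - F s) s 0).
      replace 0 with (f (s + omega) - f s) by (rewrite Hp; apply Rminus_diag).
      apply (is_derive_minus (fun s => F (s + omega)) F); [|apply Hd].
      rewrite <- (Rmult_1_l (f (s + omega))).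
      apply (is_derive_comp F (fun s => s + omega)); [apply Hd|].
      auto_derive; [easy | ring]. }
    assert (E0 : F (0 + omega) - F 0 = 0)
      by (unfold F; rewrite Rplus_0_l, H0, RInt_point; unfold zero; simpl; ring).
    assert (E : F (0 + omega) - F 0 = F (t + omega) - F t).
    { destruct (Rtotal_order 0 t) as [Ht|[<-|Ht]]; [|reflexivity|].
      - apply (eq_is_derive (fun s => F (s + omega) - F s) 0 t); auto.
      - symmetry; apply (eq_is_derive (fun s => F (s + omega) - F s) t 0); auto. }
    rewrite E0 in E; symmetry in E; now apply Rminus_diag_uniq in E.
Qed.

(** Only the second derivative is extended by periodicity; the other two functions are its
    successive primitives, periodic because v and u agree at 0 and omega. No differentiability at
    the junctions has to be checked. *)
Lemma periodic_C2_extension (omega : R) (u v r : R -> R) : 0 < omega ->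
  (forall t, is_derive u t (v t)) -> (forall t, is_derive v t (r t)) ->
  (forall t, continuous r t) ->
  u 0 = u omega -> v 0 = v omega -> r 0 = r omega ->
  exists y y1 y2 : R -> R,
    (forall t, is_derive y t (y1 t)) /\ (forall t, is_derive y1 t (y2 t)) /\
    continuous_periodic omega y /\ continuous_periodic omega y1 /\ continuous_periodic omega y2 /\
    forall t, 0 <= t <= omega -> y t = u t /\ y1 t = v t /\ y2 t = r t.
Proof.
  intros Hom Du Dv Cr Pu Pv Pr.
  assert (Hint : forall w w' wt : R -> R, (forall t, is_derive w t (w' t)) ->
    (forall t, continuous w' t) ->
    (forall t, 0 <= t <= omega -> wt t = w' t) ->
    forall t, 0 <= t <= omega -> RInt wt 0 t = w t - w 0).
  { intros w w' wt Dw Cw' Ew t Ht.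
    rewrite (RInt_ext wt w').
    - apply is_RInt_unique, (is_RInt_derive (V := R_CompleteNormedModule) w w'); auto.
    - intros s; rewrite Rmin_left, Rmax_right by lra; intros Hs; apply Ew; lra. }
  destruct (periodic_extension omega r Hom Cr Pr) as [y2 [H2 E2]].
  destruct (periodic_primitive omega (v 0) y2 Hom H2) as [H1 D1].
  { rewrite (Hint v r) by (auto; lra); lra. }
  set (y1 := fun t => v 0 + RInt y2 0 t) in *.
  assert (E1 : forall t, 0 <= t <= omega -> y1 t = v t)
    by (intros t Ht; unfold y1; rewrite (Hint v r) by auto; ring).
  destruct (periodic_primitive omega (u 0) y1 Hom H1) as [H0 D0].
  { rewrite (Hint u v) by (auto; try lra; apply (continuous_of_is_derive v r Dv)); lra. }
  set (y := fun t => u 0 + RInt y1 0 t) in *.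
  assert (E0 : forall t, 0 <= t <= omega -> y t = u t).
  { intros t Ht; unfold y; rewrite (Hint u v) by (auto; apply (continuous_of_is_derive v r Dv)); ring. }
  exists y, y1, y2; repeat (split; [assumption|]).
  intros t Ht; auto.
Qed.

(** * The truncated equation *)

Lemma continuous_lipschitz_family (f : R -> R -> R -> R) (L : R) (u v : R -> R) :
  0 <= L ->
  (forall t a b a' b', Rabs (f t a b - f t a' b') <= L * (Rabs (a - a') + Rabs (b - b'))) ->
  (forall a b t, continuous (fun s => f s a b) t) ->
  (forall t, continuous u t) -> (forall t, continuous v t) ->
  forall t, continuous (fun s => f s (u s) (v s)) t.
Proof.
  intros HL Hlip Hf Hu Hv t; apply filterlim_locally; intros eps.
  pose proof (cond_pos eps) as Heps.
  assert (H1 : 0 < eps / 2) by lra.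
  assert (H2 : 0 < eps / 2 / (2 * L + 2)) by (apply Rdiv_lt_0_compat; lra).
  pose proof (proj1 (filterlim_locally _ _) (Hf (u t) (v t) t) (mkposreal _ H1)) as B1.
  pose proof (proj1 (filterlim_locally _ _) (Hu t) (mkposreal _ H2)) as B2.
  pose proof (proj1 (filterlim_locally _ _) (Hv t) (mkposreal _ H2)) as B3.
  generalize (filter_and _ _ B1 (filter_and _ _ B2 B3)); apply filter_imp.
  intros s [C1 [C2 C3]].
  change (Rabs (f s (u t) (v t) - f t (u t) (v t)) < eps / 2) in C1.
  change (Rabs (u s - u t) < eps / 2 / (2 * L + 2)) in C2.
  change (Rabs (v s - v t) < eps / 2 / (2 * L + 2)) in C3.
  change (Rabs (f s (u s) (v s) - f t (u t) (v t)) < eps).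
  specialize (Hlip s (u s) (v s) (u t) (v t)).
  replace (f s (u s) (v s) - f t (u t) (v t))
    with ((f s (u s) (v s) - f s (u t) (v t)) + (f s (u t) (v t) - f t (u t) (v t))) by ring.
  apply Rle_lt_trans with (1 := Rabs_triang _ _).
  set (q := eps / 2 / (2 * L + 2)) in *.
  assert (Hq : eps / 2 = (2 * L + 2) * q) by (unfold q; field; lra).
  assert (L * (Rabs (u s - u t) + Rabs (v s - v t)) <= L * (q + q))
    by (apply Rmult_le_compat_l; lra).
  lra.
Qed.

Lemma Rpower_pos (x y : R) : 0 < Rpower x y.
Proof. apply exp_pos. Qed.

Lemma Rpower_lipschitz (m g x y : R) : 0 < m -> 0 < g -> g < 1 -> m <= x -> m <= y ->
  Rabs (Rpower x g - Rpower y g) <= g * / Rpower m (1 - g) * Rabs (x - y).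
Proof.
  intros Hm Hg0 Hg1 Hx Hy.
  destruct (MVT_gen (fun z => Rpower z g) y x (fun z => g * Rpower z (g - 1))) as [c [Hc E]].
  - intros z Hz; apply is_derive_Reals, derivable_pt_lim_power.
    pose proof (Rmin_glb y x m Hy Hx); lra.
  - intros z Hz; apply derivable_continuous_pt.
    exists (g * Rpower z (g - 1)); apply derivable_pt_lim_power.
    pose proof (Rmin_glb y x m Hy Hx); lra.
  - rewrite E, Rabs_mult; apply Rmult_le_compat_r; [apply Rabs_pos|].
    rewrite Rabs_pos_eq by (apply Rmult_le_pos; [lra | left; apply Rpower_pos]).
    apply Rmult_le_compat_l; [lra|].
    replace (g - 1) with (- (1 - g)) by ring; rewrite Rpower_Ropp.
    apply Rinv_le_contravar; [apply Rpower_pos|].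
    apply Rle_Rpower_l; [lra|]; split; [exact Hm|].
    pose proof (Rmin_glb y x m Hy Hx); lra.
Qed.

Lemma sublinear_dominated (P Q eps g m : R) : 0 < eps -> 0 <= Q -> g < 1 ->
  exists r, 0 < r /\ m < r /\ P + Q * Rpower r g <= eps * r.
Proof.
  intros Heps HQ Hg.
  (* Beyond [r0] the power term is at most eps r/2, and beyond 2P/eps so is the constant; Q + 1
     keeps the base positive when Q = 0. *)
  set (r0 := Rpower (2 * (Q + 1) / eps) (/ (1 - g))).
  set (r := Rmax r0 (Rmax (m + 1) (2 * P / eps))).
  assert (Hr0 : 0 < r0) by apply Rpower_pos.
  assert (Hrr0 : r0 <= r) by apply Rmax_l.
  assert (Hrm : m + 1 <= r) by (eapply Rle_trans; [apply Rmax_l | apply Rmax_r]).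
  assert (HrP : 2 * P / eps <= r) by (eapply Rle_trans; [apply Rmax_r | apply Rmax_r]).
  exists r; split; [lra|]; split; [lra|].
  assert (H1 : 2 * P <= eps * r) by (apply Rle_div_l in HrP; lra).
  assert (Hq : 0 < 2 * (Q + 1) / eps) by (apply Rdiv_lt_0_compat; lra).
  assert (H2 : 2 * (Q + 1) / eps <= Rpower r (1 - g)).
  { replace (2 * (Q + 1) / eps) with (Rpower r0 (1 - g)).
    - apply Rle_Rpower_l; lra.
    - unfold r0; rewrite Rpower_mult, Rinv_l, Rpower_1; lra. }
  assert (H3 : r = Rpower r g * Rpower r (1 - g)).
  { rewrite <- Rpower_plus; replace (g + (1 - g)) with 1 by ring; rewrite Rpower_1; lra. }
  pose proof (Rpower_pos r g).
  apply Rle_div_l in H2; [|lra].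
  assert (Rpower r g * (2 * (Q + 1)) <= Rpower r g * (Rpower r (1 - g) * eps))
    by (apply Rmult_le_compat_l; lra).
  nra.
Qed.

Section Truncation.

Variables (m Rd delta : R).
Hypotheses (hm : 0 < m) (hmR : m < Rd) (hdelta : 0 <= delta).

Definition trunc (u : R) : R := clamp m Rd u.
(** The window scales with the clamped value, so that the square of the clamped slope over [trunc u]
    is at most delta^2 times [trunc u]. *)
Definition trunc_slope (u v : R) : R := clamp (- (delta * trunc u)) (delta * trunc u) v.

Lemma trunc_bounds u : m <= trunc u <= Rd.
Proof. apply clamp_bounds; lra. Qed.

Lemma trunc_slope_bound u v : Rabs (trunc_slope u v) <= delta * trunc u.
Proof.
  pose proof (trunc_bounds u).
  assert (0 <= delta * trunc u) by (apply Rmult_le_pos; lra).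
  apply Rabs_le_between, clamp_bounds; lra.
Qed.

Lemma trunc_lipschitz u u' : Rabs (trunc u - trunc u') <= Rabs (u - u').
Proof.
  apply Rle_trans with (1 := clamp_lipschitz _ _ _ _ _ _).
  rewrite !Rminus_diag, Rabs_R0.
  repeat apply Rmax_lub; try apply Rabs_pos; apply Rle_refl.
Qed.

Lemma trunc_slope_lipschitz u v u' v' :
  Rabs (trunc_slope u v - trunc_slope u' v') <= delta * Rabs (u - u') + Rabs (v - v').
Proof.
  pose proof (Rmult_le_compat_l _ _ _ hdelta (trunc_lipschitz u u')) as H.
  pose proof (Rabs_pos (v - v')); pose proof (Rabs_pos (delta * (trunc u - trunc u'))) as H1.
  assert (E : Rabs (delta * (trunc u - trunc u')) = delta * Rabs (trunc u - trunc u'))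
    by (rewrite Rabs_mult, Rabs_pos_eq; auto).
  apply Rle_trans with (1 := clamp_lipschitz _ _ _ _ _ _).
  repeat apply Rmax_lub.
  - replace (- (delta * trunc u) - - (delta * trunc u')) with (- (delta * (trunc u - trunc u'))) by ring.
    rewrite Rabs_Ropp; lra.
  - rewrite <- Rmult_minus_distr_l; lra.
  - lra.
Qed.

Lemma trunc_quotient_bound u v : 0 <= trunc_slope u v ^ 2 / trunc u <= delta ^ 2 * Rd.
Proof.
  pose proof (trunc_bounds u); pose proof (trunc_slope_bound u v) as H1.
  split.
  - apply Rdiv_le_0_compat; [apply pow2_ge_0 | lra].
  - apply Rle_div_l; [lra|]; rewrite <- pow2_abs.
    pose proof (Rabs_pos (trunc_slope u v)).
    assert (Rabs (trunc_slope u v) ^ 2 <= (delta * trunc u) ^ 2) by (apply pow_incr; lra).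
    assert (trunc u * trunc u <= Rd * trunc u) by (apply Rmult_le_compat_r; lra).
    pose proof (pow2_ge_0 delta); nra.
Qed.

Lemma trunc_quotient_lipschitz u v u' v' :
  Rabs (trunc_slope u v ^ 2 / trunc u - trunc_slope u' v' ^ 2 / trunc u')
    <= (2 * delta * Rd / m * (1 + delta) + delta ^ 2 * Rd / m) * (Rabs (u - u') + Rabs (v - v')).
Proof.
  pose proof (trunc_bounds u) as B; pose proof (trunc_bounds u') as B'.
  pose proof (trunc_slope_bound u v) as S; pose proof (trunc_slope_bound u' v') as S'.
  pose proof (trunc_slope_lipschitz u v u' v') as LS.
  pose proof (trunc_lipschitz u u') as LY.
  pose proof (trunc_quotient_bound u' v') as Q.
  set (Y := trunc u) in *; set (Y' := trunc u') in *.
  set (W := trunc_slope u v) in *; set (W' := trunc_slope u' v') in *.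
  pose proof (Rabs_pos (u - u')); pose proof (Rabs_pos (v - v')).
  pose proof (Rabs_pos (W - W')); pose proof (Rabs_pos (Y - Y')).
  (* In this form a single factor 1/Y <= 1/m occurs; the other quotient is already bounded by
     delta^2 Rd. *)
  replace (W ^ 2 / Y - W' ^ 2 / Y')
    with (/ Y * ((W + W') * (W - W') - W' ^ 2 / Y' * (Y - Y'))) by (field; lra).
  rewrite Rabs_mult, (Rabs_pos_eq (/ Y)) by (left; apply Rinv_0_lt_compat; lra).
  apply Rle_trans with (/ m * (2 * delta * Rd * ((1 + delta) * (Rabs (u - u') + Rabs (v - v')))
                        + delta ^ 2 * Rd * (Rabs (u - u') + Rabs (v - v')))).
  2: { right; field; lra. }
  apply Rmult_le_compat; [left; apply Rinv_0_lt_compat; lra | apply Rabs_pos | |].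
  - apply Rinv_le_contravar; lra.
  - apply Rle_trans with (1 := Rabs_triang _ _).
    rewrite Rabs_Ropp, !Rabs_mult, (Rabs_pos_eq (W' ^ 2 / Y')) by apply Q.
    apply Rplus_le_compat.
    + apply Rmult_le_compat; try apply Rabs_pos.
      * apply Rle_trans with (1 := Rabs_triang _ _).
        assert (delta * Y <= delta * Rd) by (apply Rmult_le_compat_l; lra).
        assert (delta * Y' <= delta * Rd) by (apply Rmult_le_compat_l; lra).
        lra.
      * assert (0 <= delta * Rabs (v - v')) by (apply Rmult_le_pos; lra); lra.
    + apply Rmult_le_compat; try apply Q; lra.
Qed.

Variables (omega g : R) (a e : R -> R).
Hypotheses (homega : 0 < omega) (hg0 : 0 < g) (hg1 : g < 1).
Hypotheses (ha : continuous_periodic omega a) (he : continuous_periodic omega e).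

Definition truncated (t u v : R) : R :=
  a t + e t * Rpower (trunc u) g + g * (trunc_slope u v ^ 2 / trunc u).

Lemma truncated_lipschitz : exists L, 0 <= L /\ forall t u v u' v',
  Rabs (truncated t u v - truncated t u' v') <= L * (Rabs (u - u') + Rabs (v - v')).
Proof.
  destruct (continuous_periodic_bounded omega e homega he) as [Me [HMe0 HMe]].
  set (L1 := g * / Rpower m (1 - g)).
  set (L2 := 2 * delta * Rd / m * (1 + delta) + delta ^ 2 * Rd / m).
  assert (HL1 : 0 <= L1)
    by (apply Rmult_le_pos; [lra | left; apply Rinv_0_lt_compat, Rpower_pos]).
  assert (HL2 : 0 <= L2).
  { assert (0 <= Rd / m) by (apply Rdiv_le_0_compat; lra).
    unfold L2; replace (2 * delta * Rd / m * (1 + delta) + delta ^ 2 * Rd / m)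
      with (Rd / m * (2 * delta * (1 + delta) + delta ^ 2)) by (field; lra).
    apply Rmult_le_pos; [assumption | nra]. }
  exists (Me * L1 + g * L2); split; [nra|].
  intros t u v u' v'; unfold truncated.
  set (N := Rabs (u - u') + Rabs (v - v')).
  pose proof (Rabs_pos (v - v')).
  match goal with |- Rabs ?x <= _ => replace x
    with (e t * (Rpower (trunc u) g - Rpower (trunc u') g)
          + g * (trunc_slope u v ^ 2 / trunc u - trunc_slope u' v' ^ 2 / trunc u')) by ring end.
  apply Rle_trans with (1 := Rabs_triang _ _).
  rewrite !Rabs_mult, (Rabs_pos_eq g) by lra.
  rewrite Rmult_plus_distr_r; apply Rplus_le_compat.
  - rewrite Rmult_assoc; apply Rmult_le_compat; try apply Rabs_pos; [apply HMe|].
    apply Rle_trans with (L1 * Rabs (trunc u - trunc u')).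
    + apply Rpower_lipschitz; try lra; apply trunc_bounds.
    + apply Rmult_le_compat_l; [exact HL1|].
      pose proof (trunc_lipschitz u u'); unfold N; lra.
  - rewrite Rmult_assoc; apply Rmult_le_compat_l; [lra|].
    apply trunc_quotient_lipschitz.
Qed.

Lemma truncated_continuous (u v t : R) : continuous (fun s => truncated s u v) t.
Proof.
  apply (continuous_plus (V := R_NormedModule)); [|apply continuous_const].
  apply (continuous_plus (V := R_NormedModule)); [apply ha|].
  apply (continuous_mult e (fun _ => Rpower (trunc u) g)); [apply he | apply continuous_const].
Qed.

Lemma truncated_periodic t u v : truncated (t + omega) u v = truncated t u v.
Proof. unfold truncated; now rewrite (proj2 ha), (proj2 he). Qed.

Lemma truncated_le (A E : R) (t u v : R) :
  Rabs (a t) <= A -> Rabs (e t) <= E ->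
  truncated t u v <= A + E * Rpower Rd g + g * (delta ^ 2 * Rd).
Proof.
  intros HA HE; unfold truncated.
  pose proof (trunc_bounds u); pose proof (trunc_quotient_bound u v).
  pose proof (Rle_abs (a t)); pose proof (Rle_abs (e t)).
  pose proof (Rpower_pos (trunc u) g).
  assert (Rpower (trunc u) g <= Rpower Rd g) by (apply Rle_Rpower_l; lra).
  assert (e t * Rpower (trunc u) g <= E * Rpower Rd g).
  { pose proof (Rabs_pos (e t)).
    apply Rle_trans with (E * Rpower (trunc u) g).
    - apply Rmult_le_compat_r; lra.
    - apply Rmult_le_compat_l; lra. }
  assert (g * (trunc_slope u v ^ 2 / trunc u) <= g * (delta ^ 2 * Rd))
    by (apply Rmult_le_compat_l; lra).
  lra.
Qed.

Lemma truncated_inactive t u v : m <= u <= Rd -> Rabs v <= delta * u ->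
  truncated t u v = a t + e t * Rpower u g + g * (v ^ 2 / u).
Proof.
  intros Hu Hv; unfold truncated, trunc_slope, trunc.
  rewrite (clamp_id m Rd u Hu), clamp_id; [reflexivity|].
  now apply Rabs_le_between.
Qed.

End Truncation.

(** * Existence from a lower bound on the right-hand side *)

Section Existence.

Variables (omega : R) (p k : R -> R) (G : R -> R -> R).
Hypothesis homega : 0 < omega.
Hypotheses (hp : continuous_periodic omega p) (hk : continuous_periodic omega k).
Hypothesis hG : is_periodic_Green_function omega p k G.
Variables (Gmin Gmax D : R).
Hypothesis hGmin : 0 < Gmin.
Hypothesis hGb : forall t s, 0 <= t <= omega -> 0 <= s <= omega -> Gmin <= G t s <= Gmax.
Hypothesis hD : is_lub (Green_derivative_values omega G) D.

Variables (a e beta : R -> R) (g m : R).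
Hypotheses (ha : continuous_periodic omega a) (he : continuous_periodic omega e).
Hypotheses (hg0 : 0 < g) (hg1 : g < 1) (hm : 0 < m).
Hypothesis hbeta : forall t, continuous beta t.
Hypothesis hbeta0 : forall t, 0 <= beta t.
Hypothesis hbeta_le : forall t y, m <= y -> beta t <= a t + e t * Rpower y g.
Hypothesis hbeta_int : m <= Gmin * RInt beta 0 omega.
Hypothesis hsmall : Gmax * omega * (g * (D / Gmin) ^ 2) < 1.

(** [beta] lies below the clamped right-hand side whatever [Rd] is. Its nonnegativity allows the
    Green's function bounds to be used, and its integral yields y >= m. *)
Theorem quasilinear_periodic_solution : exists y y1 y2 : R -> R,
  (forall t, is_derive y t (y1 t)) /\ (forall t, is_derive y1 t (y2 t)) /\
  continuous_periodic omega y /\ continuous_periodic omega y1 /\ continuous_periodic omega y2 /\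
  forall t, m <= y t /\
    y2 t + p t * y1 t + k t * y t = a t + e t * Rpower (y t) g + g * (y1 t ^ 2 / y t).
Proof.
  assert (HD : 0 <= D)
    by now apply (Green_derive_bound_nonneg omega p k G homega hp hk hG).
  set (delta := D / Gmin) in *.
  assert (Hdelta : 0 <= delta) by now apply Rdiv_le_0_compat.
  assert (HGmax : 0 < Gmax) by (pose proof (hGb 0 0 ltac:(lra) ltac:(lra)); lra).
  destruct (continuous_periodic_bounded omega a homega ha) as [A [HA0 HA]].
  destruct (continuous_periodic_bounded omega e homega he) as [E [HE0 HE]].
  assert (HGo : 0 < Gmax * omega) by now apply Rmult_lt_0_compat.
  (* The quadratic term takes the share Gmax omega g delta^2 < 1 of [Rd]; the rest is left for the
     constant and sublinear terms. The outcome says exactly Gmax omega H <= Rd. *)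
  destruct (sublinear_dominated (Gmax * omega * A) (Gmax * omega * E)
    (1 - Gmax * omega * (g * delta ^ 2)) g m) as [Rd [HRd [HmR Hdom]]];
    [lra | apply Rmult_le_pos; lra | lra |].
  set (f := truncated m Rd delta g a e).
  set (H := A + E * Rpower Rd g + g * (delta ^ 2 * Rd)).
  assert (Hf_ge : forall t u v, beta t <= f t u v).
  { intros t u v; unfold f, truncated.
    pose proof (trunc_bounds m Rd HmR u) as B.
    pose proof (trunc_quotient_bound m Rd delta hm HmR Hdelta u v) as Q.
    pose proof (hbeta_le t _ (proj1 B)).
    assert (0 <= g * (trunc_slope m Rd delta u v ^ 2 / trunc m Rd u))
      by (apply Rmult_le_pos; lra).
    lra. }
  assert (Hf_le : forall t u v, f t u v <= H)
    by (intros t u v; apply truncated_le; auto; lra).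
  destruct (truncated_lipschitz m Rd delta hm HmR Hdelta omega g a e homega hg0 hg1 he)
    as [L [HL Hlip]]; fold f in Hlip.
  assert (Hf_cont : forall u v : R -> R,
    (forall t, continuous u t) -> (forall t, continuous v t) ->
    forall t, continuous (fun s => f s (u s) (v s)) t).
  { intros u v; apply (continuous_lipschitz_family f L); auto.
    intros x y t; now apply (truncated_continuous m Rd delta omega). }
  destruct (bounded_nonlinearity_periodic_solution omega p k G homega hp hk hG f L H)
    as [u [v [r [Du [Dv [Cr [Pu [Pv [Pr Huv]]]]]]]]]; auto; try lra.
  { intros t x y; apply Rabs_le_between.
    pose proof (Hf_ge t x y); pose proof (Hf_le t x y); pose proof (hbeta0 t); lra. }
  { intros t x y; now apply truncated_periodic. }
  set (h := fun s => f s (u s) (v s)).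
  assert (Ch : forall s, continuous h s)
    by (apply Hf_cont; [apply (continuous_of_is_derive u v Du) | apply (continuous_of_is_derive v r Dv)]).
  assert (Hh0 : forall s, 0 <= h s)
    by (intros s; apply Rle_trans with (1 := hbeta0 s), Hf_ge).
  set (J := RInt h 0 omega).
  assert (HJ1 : RInt beta 0 omega <= J).
  { apply RInt_le; [lra | now apply ex_RInt_of_continuous .. |]; intros s _; apply Hf_ge. }
  assert (HJ2 : J <= omega * H).
  { apply Rle_trans with (RInt (fun _ => H) 0 omega).
    - apply RInt_le; [lra | now apply ex_RInt_of_continuous | apply ex_RInt_const |].
      intros s _; apply Hf_le.
    - rewrite RInt_const; change (scal (omega - 0) H) with ((omega - 0) * H); lra. }
  assert (HuJ : forall t, 0 <= t <= omega -> Gmin * J <= u t <= Gmax * J).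
  { intros t Ht; rewrite (proj2 (Huv t Ht)).
    apply (Green_integral_bounds omega p k G homega hG Gmin Gmax t h); auto. }
  assert (HvJ : forall t, 0 <= t <= omega -> Rabs (v t) <= D * J).
  { intros t Ht.
    apply (Green_integral_derivative_bound omega p k G homega hp hk hG D hD h u t); auto.
    intros s Hs; apply (proj2 (Huv s Hs)). }
  assert (Hact : forall t, 0 <= t <= omega -> m <= u t <= Rd /\ Rabs (v t) <= delta * u t).
  { intros t Ht; specialize (HuJ t Ht); specialize (HvJ t Ht); repeat split.
    - apply Rle_trans with (1 := hbeta_int).
      apply Rle_trans with (2 := proj1 HuJ); apply Rmult_le_compat_l; lra.
    - apply Rle_trans with (1 := proj2 HuJ).
      apply Rle_trans with (Gmax * (omega * H)); [apply Rmult_le_compat_l; lra|].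
      unfold H; lra.
    - apply Rle_trans with (1 := HvJ).
      replace (D * J) with (delta * (Gmin * J)) by (unfold delta; field; lra).
      apply Rmult_le_compat_l; lra. }
  destruct (periodic_C2_extension omega u v r homega Du Dv Cr Pu Pv Pr)
    as [y [y1 [y2 [Dy [Dy1 [Py [Py1 [Py2 Ey]]]]]]]].
  exists y, y1, y2; do 5 (split; [assumption|]).
  intros t; destruct (exists_period_shift omega t homega) as [n Hn].
  set (s := t - IZR n * omega) in *.
  assert (Hs : 0 <= s <= omega) by lra.
  assert (Et : t = s + IZR n * omega) by (unfold s; ring).
  rewrite Et.
  rewrite (periodic_IZR omega y (proj2 Py)), (periodic_IZR omega y1 (proj2 Py1)),
    (periodic_IZR omega y2 (proj2 Py2)), (periodic_IZR omega p (proj2 hp)),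
    (periodic_IZR omega k (proj2 hk)), (periodic_IZR omega a (proj2 ha)),
    (periodic_IZR omega e (proj2 he)).
  destruct (Ey s Hs) as [-> [-> ->]].
  destruct (Hact s Hs) as [B1 B2]; split; [apply B1|].
  rewrite (proj1 (Huv s Hs)); now apply truncated_inactive.
Qed.

End Existence.

(** * The two equations *)

Lemma C2_of_is_derive (y y1 y2 : R -> R) :
  (forall t, is_derive y t (y1 t)) -> (forall t, is_derive y1 t (y2 t)) ->
  (forall t, continuous y2 t) ->
  is_C2 y /\ (forall t, Derive y t = y1 t) /\ (forall t, Derive (Derive y) t = y2 t).
Proof.
  intros D1 D2 C2.
  assert (E1 : forall t, Derive y t = y1 t) by (intros t; now apply is_derive_unique).
  assert (E2 : forall t, Derive (Derive y) t = y2 t).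
  { intros t; rewrite (Derive_ext _ y1 t E1); now apply is_derive_unique. }
  split; [|now split].
  intros t; split; [now exists (y1 t)|]; split.
  - exists (y2 t); apply (is_derive_ext y1); [intros s; symmetry; apply E1 | apply D2].
  - apply (continuous_ext y2); [intros s; symmetry; apply E2 | apply C2].
Qed.

Lemma C1_norm_exists (omega m : R) (y y1 : R -> R) : 0 < omega ->
  (forall t, is_derive y t (y1 t)) -> (forall t, continuous y1 t) ->
  (forall t, m <= y t) ->
  exists N, is_C1_norm omega y N /\ m <= N.
Proof.
  intros Hom Dy Cy1 Hm.
  assert (Hmax : forall f : R -> R, (forall t, continuous f t) ->
    exists M, is_max_on (period_interval omega) (fun t => Rabs (f t)) M).
  { intros f Hf.
    destruct (continuity_ab_maj (fun t => Rabs (f t)) 0 omega) as [tm [H1 H2]].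
    - lra.
    - intros c _; apply continuity_pt_filterlim, (continuous_comp f Rabs);
        [apply Hf | apply continuous_Rabs].
    - exists (Rabs (f tm)); split; [now exists tm | exact H1]. }
  destruct (Hmax y (continuous_of_is_derive y y1 Dy)) as [m0 H0].
  destruct (Hmax (Derive y)) as [m1 H1].
  { intros t; apply (continuous_ext y1); [|apply Cy1].
    intros s; symmetry; now apply is_derive_unique. }
  exists (m0 + m1); split; [now exists m0, m1|].
  assert (H2 : 0 <= m1)
    by (destruct H1 as [[x [_ <-]] _]; apply Rabs_pos).
  assert (H3 : Rabs (y 0) <= m0) by (apply H0; unfold period_interval; lra).
  pose proof (Hm 0); pose proof (Rle_abs (y 0)); lra.
Qed.

Lemma is_derive_Rpower_comp (y : R -> R) (l g t : R) : 0 < y t -> is_derive y t l ->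
  is_derive (fun s => Rpower (y s) g) t (g * Rpower (y t) (g - 1) * l).
Proof.
  intros Hy Hl; rewrite Rmult_comm.
  apply (is_derive_comp (fun z => Rpower z g) y); [|exact Hl].
  now apply is_derive_Reals, derivable_pt_lim_power.
Qed.

(** With Z = y^(1-alpha) one has x = y/Z, x' = alpha y'/Z and x'' = (alpha/Z)(y'' - (1-alpha)
    y'^2/y), so the gradient term is the one created by the substitution; and x^rho = Z because
    alpha rho = 1 - alpha. *)
Lemma power_of_transformed_solution (omega rho alpha : R) (p q b c e y y1 y2 : R -> R) :
  0 < rho -> alpha = 1 / (rho + 1) ->
  (forall t, is_derive y t (y1 t)) -> (forall t, is_derive y1 t (y2 t)) ->
  (forall t, continuous y2 t) -> periodic omega y -> (forall t, 0 < y t) ->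
  (forall t, y2 t + p t * y1 t + q t / alpha * y t
     = (b t + c t) / alpha + e t / alpha * Rpower (y t) (1 - alpha)
       + (1 - alpha) * (y1 t ^ 2 / y t)) ->
  positive_periodic_solution omega p q (singular_rhs rho rho b c e)
    (fun t => Rpower (y t) alpha).
Proof.
  intros Hrho Halpha D1 D2 C2 Py Hpos Heq.
  assert (Ha : 0 < alpha) by (rewrite Halpha; apply Rdiv_lt_0_compat; lra).
  assert (Har : alpha * rho = 1 - alpha) by (rewrite Halpha; field; lra).
  set (x1 := fun t => alpha * Rpower (y t) (alpha - 1) * y1 t).
  set (x2 := fun t => alpha * ((alpha - 1) * Rpower (y t) (alpha - 1 - 1) * y1 t * y1 t
                      + Rpower (y t) (alpha - 1) * y2 t)).
  assert (Dx1 : forall t, is_derive (fun t => Rpower (y t) alpha) t (x1 t))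
    by (intros t; now apply is_derive_Rpower_comp).
  assert (Dx2 : forall t, is_derive x1 t (x2 t)).
  { intros t; unfold x1, x2.
    apply (is_derive_ext (fun t => alpha * (Rpower (y t) (alpha - 1) * y1 t)));
      [intros s; symmetry; apply Rmult_assoc|].
    apply is_derive_scal.
    apply (is_derive_mult (fun t => Rpower (y t) (alpha - 1)) y1);
      [now apply is_derive_Rpower_comp | apply D2 | exact Rmult_comm]. }
  assert (Cy1 := continuous_of_is_derive y1 y2 D2).
  assert (Cp : forall g t, continuous (fun t => Rpower (y t) g) t).
  { intros g; apply (continuous_of_is_derive _ (fun t => g * Rpower (y t) (g - 1) * y1 t)).
    intros t; now apply is_derive_Rpower_comp. }
  assert (Cx2 : forall t, continuous x2 t).
  { intros t; apply (continuous_scal_r (V := R_NormedModule)).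
    apply (continuous_plus (V := R_NormedModule)).
    - apply (continuous_mult (fun t => (alpha - 1) * Rpower (y t) (alpha - 1 - 1) * y1 t) y1);
        [|apply Cy1].
      apply (continuous_mult (fun t => (alpha - 1) * Rpower (y t) (alpha - 1 - 1)) y1);
        [|apply Cy1].
      apply (continuous_scal_r (V := R_NormedModule)), Cp.
    - apply (continuous_mult (fun t => Rpower (y t) (alpha - 1)) y2); [apply Cp | apply C2]. }
  destruct (C2_of_is_derive _ x1 x2 Dx1 Dx2 Cx2) as [HC2 [E1 E2]].
  split; [exact HC2|]; split; [|split].
  - intros t; now rewrite (Py t).
  - intros t; apply exp_pos.
  - intros t; rewrite E1, E2; unfold singular_rhs, x1, x2.
    rewrite Rpower_mult, Har.
    specialize (Heq t); specialize (Hpos t).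
    set (Z := Rpower (y t) (1 - alpha)) in *.
    assert (HZ : 0 < Z) by apply exp_pos.
    replace (Rpower (y t) (alpha - 1)) with (/ Z)
      by (unfold Z; rewrite <- Rpower_Ropp; f_equal; ring).
    replace (Rpower (y t) (alpha - 1 - 1)) with (/ Z / y t).
    2: { replace (alpha - 1 - 1) with (- (1 - alpha) + - (1)) by ring.
         rewrite Rpower_plus, !Rpower_Ropp, Rpower_1 by exact Hpos; reflexivity. }
    replace (Rpower (y t) alpha) with (y t / Z).
    2: { unfold Rdiv, Z; rewrite <- Rpower_Ropp, <- (Rpower_1 (y t)) at 1 by exact Hpos.
         rewrite <- Rpower_plus; f_equal; ring. }
    (* All powers are now rational in y and Z; this factor turns the left side into that of the
       equation for y with the gradient term moved over. *)
    apply (Rmult_eq_reg_r (Z / alpha)); [|apply Rgt_not_eq, Rdiv_lt_0_compat; lra].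
    transitivity (y2 t + p t * y1 t + q t / alpha * y t - (1 - alpha) * (y1 t ^ 2 / y t)).
    + field; repeat split; lra.
    + rewrite Heq; field; repeat split; lra.
Qed.

Theorem theorem3p3
    (omega : R) (homega : 0 < omega)
    (p q b c e : R -> R)
    (hp : continuous_periodic omega p)
    (hq : continuous_periodic omega q)
    (hb : continuous_periodic omega b)
    (hc : continuous_periodic omega c) (hc_pos : forall t, 0 < c t)
    (he : continuous_periodic omega e) (he_pos : forall t, 0 < e t)
    (rho1 rho2 : R) (hrho1 : 0 < rho1) (hrho2 : 0 < rho2)
    (hrho : rho1 = rho2)
    (alpha : R) (halpha : alpha = 1 / (rho1 + 1))
    (G : R -> R -> R)
    (hG : is_periodic_Green_function omega p (fun t => q t / alpha) G)
    (hG_pos : forall t s, 0 <= t <= omega -> 0 <= s <= omega -> 0 < G t s)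
    (Gmax Gmin D : R)
    (hGmax : is_max_on (period_square omega) (fun z => G (fst z) (snd z)) Gmax)
    (hGmin : is_min_on (period_square omega) (fun z => G (fst z) (snd z)) Gmin)
    (hD : is_lub (Green_derivative_values omega G) D)
    (sigma delta : R)
    (hsigma : sigma = Gmin / (Gmax + D))
    (hdelta : delta = D / Gmin)
    (bmin cmin emin : R)
    (hbmin : is_min_on (period_interval omega) b bmin)
    (hcmin : is_min_on (period_interval omega) c cmin)
    (hemin : is_min_on (period_interval omega) e emin)
    (hsmall : (1 - alpha) * (Gmax + delta * Gmin) * delta ^ 2 * omega / sigma
                < 1) :
  (0 <= bmin + cmin ->
     exists (r Rad : R) (y : R -> R) (N : R),
       0 < r /\ r < Rad /\
       positive_periodic_solution omega p (fun t => q t / alpha)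
         (transformed_rhs alpha rho2 b c e) y /\
       is_C1_norm omega y N /\ r <= N <= Rad /\
       positive_periodic_solution omega p q
         (singular_rhs rho1 rho2 b c e) (fun t => Rpower (y t) alpha))
  /\
  (bmin + cmin < 0 ->
     forall r : R, 0 < r ->
       1 / sigma * Rpower (- ((bmin + cmin) / emin)) (1 / (1 - alpha)) < r ->
       r <= Gmin * mean_pos_part omega b * omega / alpha ->
     exists (Rad : R) (y : R -> R) (N : R),
       r < Rad /\
       positive_periodic_solution omega p (fun t => q t / alpha)
         (transformed_rhs alpha rho2 b c e) y /\
       is_C1_norm omega y N /\ r <= N <= Rad /\
       positive_periodic_solution omega p q
         (singular_rhs rho1 rho2 b c e) (fun t => Rpower (y t) alpha)).
Proof.
  rewrite <- hrho in *; clear hrho hrho2 rho2.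
  assert (Ha0 : 0 < alpha) by (rewrite halpha; apply Rdiv_lt_0_compat; lra).
  assert (Har : alpha * rho1 = 1 - alpha) by (rewrite halpha; field; lra).
  assert (Ha1 : 0 < 1 - alpha) by (rewrite <- Har; now apply Rmult_lt_0_compat).
  set (k := fun t => q t / alpha) in *.
  assert (Hk : continuous_periodic omega k).
  { split.
    - intros t; apply (continuous_mult q (fun _ => / alpha)); [apply hq | apply continuous_const].
    - intros t; unfold k; now rewrite (proj2 hq t). }
  assert (HGb : forall t s, 0 <= t <= omega -> 0 <= s <= omega -> Gmin <= G t s <= Gmax).
  { intros t s Ht Hs; split;
      [apply (proj2 hGmin (t, s)) | apply (proj2 hGmax (t, s))]; now split. }
  assert (HGmin : 0 < Gmin).
  { destruct hGmin as [[[t s] [[Ht Hs] <-]] _]; now apply hG_pos. }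
  assert (HGle : Gmin <= Gmax) by (pose proof (HGb 0 0 ltac:(lra) ltac:(lra)); lra).
  assert (HD : 0 <= D) by now apply (Green_derive_bound_nonneg omega p k G homega hp Hk hG).
  assert (Hsig : 0 < sigma <= 1).
  { rewrite hsigma; split; [apply Rdiv_lt_0_compat; lra | apply Rle_div_l; lra]. }
  (* Adding delta Gmin >= 0 to Gmax and dividing by sigma <= 1 can only increase this quantity, so
     [hsmall] bounds it. *)
  assert (Hcontr : Gmax * omega * ((1 - alpha) * (D / Gmin) ^ 2) < 1).
  { rewrite <- hdelta.
    apply Rle_lt_trans with (2 := hsmall); apply (proj1 (Rle_div_r _ _ _ (proj1 Hsig))).
    assert (Hd2 : 0 <= omega * ((1 - alpha) * delta ^ 2))
      by (apply Rmult_le_pos; [lra|]; apply Rmult_le_pos; [lra | apply pow2_ge_0]).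
    assert (HdG : 0 <= delta * Gmin)
      by (rewrite hdelta; apply Rmult_le_pos; [apply Rdiv_le_0_compat; lra | lra]).
    replace ((1 - alpha) * (Gmax + delta * Gmin) * delta ^ 2 * omega)
      with ((Gmax + delta * Gmin) * (omega * ((1 - alpha) * delta ^ 2))) by ring.
    replace (Gmax * omega * ((1 - alpha) * delta ^ 2) * sigma)
      with (Gmax * sigma * (omega * ((1 - alpha) * delta ^ 2))) by ring.
    apply Rmult_le_compat_r; nra. }
  assert (hper_min : forall f fm, continuous_periodic omega f ->
    is_min_on (period_interval omega) f fm -> forall t, fm <= f t).
  { intros f fm Hf Hm t.
    destruct (periodic_reduce omega f t homega (proj2 Hf)) as [s [Hs ->]].
    now apply Hm. }
  pose proof (hper_min b bmin hb hbmin) as Hb; pose proof (hper_min c cmin hc hcmin) as Hc.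
  pose proof (hper_min e emin he hemin) as He; clear hper_min.
  assert (Hem : 0 < emin) by (destruct hemin as [[t [_ <-]] _]; apply he_pos).
  set (a := fun t => (b t + c t) / alpha).
  set (e' := fun t => e t / alpha).
  assert (Ca : continuous_periodic omega a).
  { split.
    - intros t; apply (continuous_mult (fun t => b t + c t) (fun _ => / alpha));
        [|apply continuous_const].
      apply (continuous_plus (V := R_NormedModule)); [apply hb | apply hc].
    - intros t; unfold a; now rewrite (proj2 hb t), (proj2 hc t). }
  assert (Ce : continuous_periodic omega e').
  { split.
    - intros t; apply (continuous_mult e (fun _ => / alpha)); [apply he | apply continuous_const].
    - intros t; unfold e'; now rewrite (proj2 he t). }
  assert (Hmain : forall (m : R) (beta : R -> R), 0 < m ->
    (forall t, continuous beta t) -> (forall t, 0 <= beta t) ->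
    (forall t y, m <= y -> beta t <= a t + e' t * Rpower y (1 - alpha)) ->
    m <= Gmin * RInt beta 0 omega ->
    exists (Rad : R) (y : R -> R) (N : R),
       m < Rad /\
       positive_periodic_solution omega p k
         (transformed_rhs alpha rho1 b c e) y /\
       is_C1_norm omega y N /\ m <= N <= Rad /\
       positive_periodic_solution omega p q
         (singular_rhs rho1 rho1 b c e) (fun t => Rpower (y t) alpha)).
  { intros m beta Hm Cbeta Hbeta0 Hbeta Hint.
    destruct (quasilinear_periodic_solution omega p k G homega hp Hk hG Gmin Gmax D HGmin HGb hD
      a e' beta (1 - alpha) m Ca Ce Ha1 ltac:(lra) Hm Cbeta Hbeta0 Hbeta Hint Hcontr)
      as [y [y1 [y2 [D1 [D2 [Py [Py1 [Py2 Hy]]]]]]]].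
    destruct (C1_norm_exists omega m y y1 homega D1 (proj1 Py1) (fun t => proj1 (Hy t)))
      as [N [HN HmN]].
    assert (Hpos : forall t, 0 < y t) by (intros t; destruct (Hy t); lra).
    (* [Rad] is taken just above the norm of the solution found, which also places it above [m]. *)
    exists (N + 1), y, N.
    split; [lra|]; split; [|split; [exact HN|split; [lra|]]].
    - destruct (C2_of_is_derive y y1 y2 D1 D2 (proj1 Py2)) as [HC2 [E1 E2]].
      split; [exact HC2|]; split; [apply Py|]; split; [exact Hpos|].
      intros t; rewrite E1, E2, (proj2 (Hy t)); unfold transformed_rhs.
      (* The exponent of the [c] term vanishes, so [c] joins [b] in the coefficient [a]. *)
      replace (1 - alpha - alpha * rho1) with 0 by lra.
      rewrite Rpower_O by apply Hpos; rewrite pow2_abs; unfold a, e'.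
      specialize (Hpos t); field; lra.
    - apply (power_of_transformed_solution omega rho1 alpha p q b c e y y1 y2); auto.
      + apply Py2.
      + apply Py.
      + intros t; apply (Hy t). }
  split.
  - intros Hbc.
    set (K := Gmin * omega * (emin / alpha)).
    assert (HK : 0 < K) by (repeat apply Rmult_lt_0_compat; try lra; now apply Rinv_0_lt_compat).
    (* The positive root of K m^(1-alpha) = m: with the constant [beta] below, Gmin times its
       integral is then exactly [m]. *)
    set (m := Rpower K (/ alpha)).
    assert (Hm : 0 < m) by apply exp_pos.
    assert (Hmid : K * Rpower m (1 - alpha) = m).
    { unfold m; rewrite Rpower_mult.
      rewrite <- (Rpower_1 K) at 1 by exact HK.
      rewrite <- Rpower_plus; f_equal; field; lra. }
    assert (Hea : 0 < emin / alpha) by now apply Rdiv_lt_0_compat.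
    destruct (Hmain m (fun _ => emin / alpha * Rpower m (1 - alpha)))
      as [Rad [y [N HN]]]; auto.
    + intros t; apply continuous_const.
    + intros t; apply Rmult_le_pos; [lra | left; apply exp_pos].
    + intros t y Hy.
      assert (0 <= a t).
      { apply Rdiv_le_0_compat; [|exact Ha0]; specialize (Hb t); specialize (Hc t); lra. }
      assert (emin / alpha * Rpower m (1 - alpha) <= e' t * Rpower y (1 - alpha)); [|lra].
      apply Rmult_le_compat; [lra | left; apply exp_pos | |].
      * apply Rmult_le_compat_r; [left; now apply Rinv_0_lt_compat | apply He].
      * apply Rle_Rpower_l; lra.
    + rewrite RInt_const.
      match goal with |- _ <= Gmin * ?x =>
        change x with ((omega - 0) * (emin / alpha * Rpower m (1 - alpha))) end.
      unfold K in Hmid; lra.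
    + exists m, Rad, y, N; tauto.
  - intros Hbc r Hr Hrlow Hrup.
    set (X := - ((bmin + cmin) / emin)) in *.
    assert (HX : 0 < X).
    { unfold X; replace (- ((bmin + cmin) / emin)) with (- (bmin + cmin) / emin) by (field; lra).
      apply Rdiv_lt_0_compat; lra. }
    (* Here the lower bound on [r] enters; the factor 1/sigma >= 1 may be dropped from it. *)
    assert (HXr : X <= Rpower r (1 - alpha)).
    { assert (H1 : Rpower X (1 / (1 - alpha)) <= r).
      { pose proof (exp_pos (1 / (1 - alpha) * ln X)) as Hp.
        fold (Rpower X (1 / (1 - alpha))) in Hp.
        assert (1 <= 1 / sigma) by (apply Rle_div_r; lra).
        nra. }
      replace X with (Rpower (Rpower X (1 / (1 - alpha))) (1 - alpha)) at 1.
      - apply Rle_Rpower_l; [lra|]; split; [apply exp_pos | exact H1].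
      - rewrite Rpower_mult.
        replace (1 / (1 - alpha) * (1 - alpha)) with 1 by (field; lra).
        now apply Rpower_1. }
    assert (HeX : emin * X = - (bmin + cmin)) by (unfold X; field; lra).
    assert (Cb : forall t, continuous (fun t => Rmax 0 (b t)) t).
    { intros t; apply (continuous_comp b (Rmax 0)); [apply hb|].
      apply (continuous_of_lipschitz _ 1); intros x x'; unfold Rmax, Rabs.
      repeat destruct (Rle_dec _ _); repeat destruct (Rcase_abs _); lra. }
    assert (Hia : 0 < / alpha) by now apply Rinv_0_lt_compat.
    (* For y >= r one has e y^(1-alpha) >= -(bmin + cmin) > 0, so b + c + e y^(1-alpha) is at least
       b, as c > 0, and at least 0, as b + c >= bmin + cmin. The upper bound on [r] is exactly the
       integral condition for this [beta]. *)
    destruct (Hmain r (fun t => / alpha * Rmax 0 (b t))) as [Rad [y [N HN]]]; auto.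
    + intros t; apply (continuous_scal_r (V := R_NormedModule)), Cb.
    + intros t; apply Rmult_le_pos; [lra | apply Rmax_l].
    + intros t y Hy.
      replace (a t + e' t * Rpower y (1 - alpha))
        with (/ alpha * (b t + c t + e t * Rpower y (1 - alpha)))
        by (unfold a, e'; field; lra).
      apply Rmult_le_compat_l; [lra|].
      assert (Hry : Rpower r (1 - alpha) <= Rpower y (1 - alpha))
        by (apply Rle_Rpower_l; lra).
      assert (emin * X <= e t * Rpower y (1 - alpha))
        by (apply Rmult_le_compat; try lra; apply He).
      specialize (Hb t); specialize (Hc t); specialize (hc_pos t).
      apply Rmax_lub; [lra|].
      lra.
    + apply Rle_trans with (1 := Hrup); right; unfold mean_pos_part.
      replace (RInt (fun t => / alpha * Rmax 0 (b t)) 0 omega)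
        with (/ alpha * RInt (fun t => Rmax 0 (b t)) 0 omega)
        by (symmetry; apply (RInt_scal (V := R_CompleteNormedModule)), ex_RInt_of_continuous, Cb).
      field; lra.
    + now exists Rad, y, N.
Qed.
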